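(* There exist universal constants $L_0>0$ and $C>0$ such that, for all $L\ge L_0$ and all $\ell\in\mathbb{N}^\star\cup\{\infty\}$, the estimator $\hat s=\hat s(L,\ell)$ satisfies $$C\,\mathbb{E}\left[H^2(s\mathbf{1}_A,\hat s)\right]\le \inf_{m\in\mathcal{M}_\ell}\left\{\mathbb{E}\left[H^2(s\mathbf{1}_A,V_m)\right]+\mathrm{pen}(m)\right\}.$$
   Context: Setting. Let $d\ge 1$ and $n>3$ be integers, $\mathbb{N}^\star=\{1,2,\dots\}$. $(X_i)_{i\ge 0}$ is a time-homogeneous Markov chain on a probability space $(\Omega,\mathcal{E},\mathbb{P})$ with values in $\mathbb{X}=\mathbb{R}^d$, endowed with a measure $\mu$ with $\mu([0,1]^d)=1$. For each $x$, the conditional law of $X_{i+1}$ given $X_i=x$ has a density $s(x,\cdot)$ with respect to $\mu$. The transition density $s$ is to be estimated on $A=[0,1]^{2d}$ from $X_0,\dots,X_n$. ''Universal'' means not depending on any other quantity. Loss. Let $M=\lambda_n\otimes\mu$ with $\lambda_n=n^{-1}\sum_{i=0}^{n-1}\delta_{X_i}$, and let $\mathbb{L}^1_+(\mathbb{X}^2,M)$ be the cone of non-negative $M$-integrable functions, with the distance $H$ given by $$H^2(f,f')=\frac1{2n}\sum_{i=0}^{n-1}\int_{\mathbb{X}}\left(\sqrt{f(X_i,y)}-\sqrt{f'(X_i,y)}\right)^2 d\mu(y),$$ and $H(f,V)=\inf_{g\in V}H(f,g)$. Partitions. For $j\in\mathbb{N}$, $\mathcal{K}_j$ is the set of the $2^{2dj}$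 dyadic cubes $\prod_{i=1}^{2d}I_j(l_i)$, $1\le l_i\le 2^j$, where $I_j(l)=[(l-1)2^{-j},l2^{-j})$ if $l<2^j$ and $I_j(2^j)=[(2^j-1)2^{-j},1]$. Start from the partition $\{[0,1]^{2d}\}$; at each step, for each cube of the current partition (belonging to some $\mathcal{K}_j$) one decides to divide it into the $4^d$ elements of $\mathcal{K}_{j+1}$ contained in it, or not. $\mathcal{M}_\ell$ is the set of partitions obtained in at most $\ell$ steps, and $\mathcal{M}_\infty=\bigcup_{\ell\ge1}\mathcal{M}_\ell$. For a partition $m$, $V_m=\{\sum_{K\in m}a_K\mathbf{1}_K:\ a_K\in[0,\infty)\}$, and $$\hat s_m=\sum_{K\in m}\frac{\sum_{i=0}^{n-1}\mathbf{1}_K(X_i,X_{i+1})}{\sum_{i=0}^{n-1}\int\mathbf{1}_K(X_i,x)\,d\mu(x)}\mathbf{1}_K,$$ with $0/0=0$. Selection rule. For $K\in\bigcup_{m\in\mathcal{M}_\ell}m$ and $m'\in\mathcal{M}_\ell$, let $m'\vee K=\{K'\cap K:\ K'\in m',\ K\cap K'\neq\emptyset\}$. For $L>0$ put $\mathrm{pen}(m'\vee K)=L|m'\vee K|\log n/n$ (so $\mathrm{pen}(m)=L|m|\log n/n$). Let $\alpha=(1-1/\sqrt2)/2$ and, with $0/0=0$, $$T(f,f')=\frac1{2n\sqrt2}\sum_{i=0}^{n-1}\int_{\mathbb{X}}\sqrt{f(X_i,y)+f'(X_i,y)}\left(\sqrt{f'(X_i,y)}-\sqrt{f(X_i,y)}\right)d\mu(y)$$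 $$+\frac1{n\sqrt2}\sum_{i=0}^{n-1}\frac{\sqrt{f'(X_i,X_{i+1})}-\sqrt{f(X_i,X_{i+1})}}{\sqrt{f(X_i,X_{i+1})+f'(X_i,X_{i+1})}}+\frac1{2n}\sum_{i=0}^{n-1}\int_{\mathbb{X}}(f(X_i,y)-f'(X_i,y))\,d\mu(y).$$ For $m\in\mathcal{M}_\ell$ let $$\gamma(m)=\sum_{K\in m}\sup_{m'\in\mathcal{M}_\ell}\left[\sum_{K'\in m'}\left(\alpha H^2(\hat s_m\mathbf{1}_{K\cap K'},\hat s_{m'}\mathbf{1}_{K\cap K'})+T(\hat s_m\mathbf{1}_{K\cap K'},\hat s_{m'}\mathbf{1}_{K\cap K'})\right)-\mathrm{pen}(m'\vee K)\right]+2\,\mathrm{pen}(m).$$ $\hat m$ is any element of $\mathcal{M}_\ell$ with $\gamma(\hat m)\le\inf_{m\in\mathcal{M}_\ell}\gamma(m)+1/n$, and $\hat s(L,\ell)=\hat s_{\hat m}$. *)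

(* Defs.v *)
From HB Require Import structures.
From mathcomp Require Import all_boot all_order all_algebra finmap.
From mathcomp Require Import all_classical all_reals all_analysis.

Set Implicit Arguments.
Unset Strict Implicit.
Unset Printing Implicit Defensive.

Import Order.TTheory GRing.Theory Num.Theory.
Import numFieldNormedType.Exports.

Local Open Scope classical_set_scope.
Local Open Scope ring_scope.

(* The state space R^d, with its product (= Borel) sigma-algebra. *)
Notation Rd R d := (d.-tuple (Real.sort R)).

Section markov_chain.
Context {dO} {Omega : measurableType dO} {R : realType} (P : probability Omega R).
Context {dT} {T : measurableType dT}.

(* The conditional law of X_{i+1} given X_0, ..., X_i is Q (X_i), with a kernel
   Q that does not depend on i. *)
Definition homogeneous_markov_chain (X : nat -> {RV P >-> T})
    (Q : R.-pker T ~> T) : Prop :=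
  forall (i : nat) (E : set Omega) (B : set T),
    g_sigma_preimage (fun k : 'I_i.+1 => X k : Omega -> T) E -> measurable B ->
    P (E `&` X i.+1 @^-1` B) = (\int[P]_(w in E) Q (X i w) B)%E.

Definition transition_density (mu : {measure set T -> \bar R})
    (Q : R.-pker T ~> T) (s : T * T -> R) : Prop :=
  [/\ measurable_fun [set: T * T] s,
      forall z, 0 <= s z
    & forall x B, measurable B -> Q x B = (\int[mu]_(y in B) (s (x, y))%:E)%E].

End markov_chain.

Section dyadic_partitions.
Context {R : realType} (d : nat).

Definition coord (z : Rd R d * Rd R d) (i : 'I_(d + d)) : R :=
  tnth (cat_tuple z.1 z.2) i.

Definition unit_cube : set (Rd R d) :=
  [set x | forall i : 'I_d, 0 <= tnth x i <= 1].

Definition unit_square : set (Rd R d * Rd R d) :=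
  [set z | forall i, 0 <= coord z i <= 1].

Definition dyadic_interval (j l : nat) : set R :=
  if (l < 2 ^ j)%N then [set` `[l.-1%:R / 2 ^+ j, l%:R / 2 ^+ j[]
  else [set` `[(2 ^ j).-1%:R / 2 ^+ j, 1]].

Definition dyadic_cubes (j : nat) : set (set (Rd R d * Rd R d)) :=
  [set K | exists2 l : 'I_(d + d) -> nat, (forall i, (1 <= l i <= 2 ^ j)%N) &
           K = [set z | forall i, dyadic_interval j (l i) (coord z i)]].

Definition children (K : set (Rd R d * Rd R d)) : set (set (Rd R d * Rd R d)) :=
  [set K' | exists j, [/\ dyadic_cubes j K, dyadic_cubes j.+1 K' & K' `<=` K]].

(* [D] is the set of the cubes of [m] which are divided. *)
Definition refines_in_one_step (m m' : set (set (Rd R d * Rd R d))) : Prop :=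
  exists2 D, D `<=` m & m' = (m `\` D) `|` \bigcup_(K in D) children K.

Fixpoint partitions_after (k : nat) : set (set (set (Rd R d * Rd R d))) :=
  if k is k'.+1 then
    [set m' | exists2 m, partitions_after k' m & refines_in_one_step m m']
  else [set [set unit_square]].

Definition partitions_le (l : nat) : set (set (set (Rd R d * Rd R d))) :=
  \bigcup_(k in [set k | (k <= l)%N]) partitions_after k.

(* [None] stands for l = oo. *)
Definition partitions (l : option nat) : set (set (set (Rd R d * Rd R d))) :=
  if l is Some l' then partitions_le l'
  else \bigcup_(l' in [set l' | (1 <= l')%N]) partitions_le l'.

Definition join_cube (m' : set (set (Rd R d * Rd R d)))
    (K : set (Rd R d * Rd R d)) : set (set (Rd R d * Rd R d)) :=
  [set K' `&` K | K' in [set K' | m' K' /\ K `&` K' !=set0]].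

End dyadic_partitions.
Arguments unit_cube R d : clear implicits.
Arguments unit_square R d : clear implicits.

Section selection.
Context {R : realType} (d : nat) (mu : {measure set (Rd R d) -> \bar R}).
Context (n : nat) (x : nat -> Rd R d).
Implicit Types (f g : Rd R d * Rd R d -> R) (m : set (set (Rd R d * Rd R d))).

(* [x] is the observed path. The distance lives on the cone of the non-negative
   functions f for which every integral of f (x i, _) is finite, where the
   real-valued integrals below are finite too. *)
Definition Hdist f g : R :=
  Num.sqrt (1 / (2 * n%:R) *
    \sum_(i < n) \int[mu]_y (Num.sqrt (f (x i, y)) - Num.sqrt (g (x i, y))) ^+ 2).

Definition Hdist_set f (V : set (Rd R d * Rd R d -> R)) : R :=
  inf [set Hdist f g | g in V].

Definition stepfuns m : set (Rd R d * Rd R d -> R) :=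
  [set f | exists2 a : set (Rd R d * Rd R d) -> R, (forall K, 0 <= a K) &
           f = fun z => \sum_(K \in m) a K * \1_K z].

(* Division by 0 gives 0; the ratio c / 0 with c > 0 occurs on a null event. *)
Definition shat m : Rd R d * Rd R d -> R :=
  fun z => \sum_(K \in m)
    (\sum_(i < n) \1_K (x i, x i.+1)) /
    (\sum_(i < n) \int[mu]_y (\1_K (x i, y))) * \1_K z.

Definition pen (L : R) m : R := L * #|` fset_set m|%:R * ln n%:R / n%:R.

Definition alpha : R := (1 - 1 / Num.sqrt 2) / 2.

Definition Tstat f f' : R :=
    1 / (2 * n%:R * Num.sqrt 2) * \sum_(i < n) \int[mu]_y
      (Num.sqrt (f (x i, y) + f' (x i, y)) *
       (Num.sqrt (f' (x i, y)) - Num.sqrt (f (x i, y))))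
  + 1 / (n%:R * Num.sqrt 2) * \sum_(i < n)
      (Num.sqrt (f' (x i, x i.+1)) - Num.sqrt (f (x i, x i.+1))) /
       Num.sqrt (f (x i, x i.+1) + f' (x i, x i.+1))
  + 1 / (2 * n%:R) * \sum_(i < n) \int[mu]_y (f (x i, y) - f' (x i, y)).

Definition local_gain m m' K K' : R :=
  let f := shat m \* \1_(K `&` K') in
  let f' := shat m' \* \1_(K `&` K') in
  alpha * Hdist f f' ^+ 2 + Tstat f f'.

Definition crit (L : R) (l : option nat) m : \bar R :=
  (\sum_(K \in m)
     ereal_sup [set (\sum_(K' \in m') local_gain m m' K K'
                     - pen L (join_cube m' K))%:E | m' in partitions l]
   + (2 * pen L m)%:E)%E.

Definition selected (L : R) (l : option nat) m : Prop :=
  partitions l m /\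
  (crit L l m <= ereal_inf [set crit L l m' | m' in partitions l]
                 + (1 / n%:R)%:E)%E.

End selection.

(* Main.v *)
(* For a cube [J] let [N J] be the number of indices [i < n] with (X_i, X_{i+1}) in [J], and
   [S J] its compensator, the sum of the integrals of [s (X_i, _)] over the section of [J].
   Every quantity in the selection rule is a sum over cubes of terms which depend on the data
   only through [N J] and integrals, and the random error in [Tstat] comes from the
   differences [N J - S J]. So everything follows from a bound, uniform over the dyadic
   partitions [m], of the sum over [J] in [m] of (sqrt (N J) - sqrt (S J))^2 by a multiple of
   |m| log n, up to a remainder of bounded expectation.

   For disjoint cubes and arbitrary reals lam_J, the exponential of the sum of the
   lam_J N J - (exp lam_J - 1) S J has expectation at most 1, by the Markov property. Average
   over lam_J in a grid of 2n + 1 points, whose maximum recovers the square above up to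
   constants, and mix over all the dyadic partitions with weights given by powers of 1/2:
   the resulting [tree_weight] still has expectation at most 1, and its logarithm dominates
   the exponents of all the partitions at once. As [tree_weight] is a product over the
   children of a cube, this bound splits into contributions of the cubes of a partition,
   which deals with the suprema taken separately for each cube in [crit].

   On each path, Baraud's inequality for the test [Tstat] bounds [crit] from above at any [m];
   the antisymmetry of [Tstat] bounds it from below at the selected partition. *)

Require Import Defs.
From HB Require Import structures.
From mathcomp Require Import all_boot all_order all_algebra finmap.
From mathcomp Require Import all_classical all_reals all_analysis measurable_realfun.
From mathcomp Require Import ring lra.

Set Implicit Arguments.
Unset Strict Implicit.
Unset Printing Implicit Defensive.

Import Order.TTheory GRing.Theory Num.Theory.
Import numFieldNormedType.Exports.

Local Open Scope classical_set_scope.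
Local Open Scope ring_scope.

(** * The Markov property for functions *)

Section image_measure.
Context {d d'} {T1 : measurableType d} {T2 : measurableType d'} {R : realType}.

Definition image_measure (m : {measure set T1 -> \bar R}) (f : T1 -> T2)
  (mf : measurable_fun [set: T1] f) : {measure set T2 -> \bar R} :=
  measure_function_pushforward__canonical__measure_function_Measure m mf.

Lemma integral_image_measure (m : {measure set T1 -> \bar R}) (f : T1 -> T2)
    (mf : measurable_fun [set: T1] f) (h : T2 -> \bar R) :
  measurable_fun [set: T2] h -> (forall y, 0 <= h y)%E ->
  (\int[image_measure m mf]_y h y = \int[m]_x h (f x))%E.
Proof.
move=> mh h0; have := @ge0_integral_pushforward _ _ _ _ _ _ mf m setT h.
by rewrite preimage_setT; apply.
Qed.

End image_measure.

Section markov_integral.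
Context {dO} {Omega : measurableType dO} {R : realType} (P : probability Omega R).
Context {dT} {T : measurableType dT}.
Variables (X : nat -> {RV P >-> T}) (Q : R.-pker T ~> T).
Hypothesis hX : homogeneous_markov_chain X Q.

(** The same generating family as in [homogeneous_markov_chain], so that the measurable sets of
    [pastType i] are exactly the events to which the hypothesis applies. *)
Definition past i : set (set Omega) :=
  \big[setU/set0]_(k < i.+1) preimage_set_system setT (X k) measurable.

Definition pastType i : measurableType (past i).-sigma := g_sigma_algebraType (past i).

Lemma past_measurable i (E : set Omega) : <<s past i >> E -> measurable E.
Proof.
apply: smallest_sub => /=; first exact: sigma_algebra_measurable.
rewrite /past -bigcup_mkord_ord => A [k _] [B mB <-].
by rewrite setTI; apply: measurable_funPTI.
Qed.

Lemma measurable_past i k : (k <= i)%N ->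
  measurable_fun [set: pastType i] (X k : pastType i -> T).
Proof.
move=> ki _ /= B mB; rewrite setTI; apply: sub_sigma_algebra.
rewrite /past -bigcup_mkord_ord; exists k; first by rewrite /= ltnS.
by exists B => //; rewrite setTI inordK.
Qed.

Lemma measurable_of_past i : measurable_fun [set: Omega] (id : Omega -> pastType i).
Proof. by move=> _ /= B mB; rewrite setTI; exact: past_measurable mB. Qed.

Section step_kernel.
Variable i : nat.

(** The [unit] factor is the source of [past_law]: the second kernel in [kcomp] also takes the
    argument of the first. *)
Definition step_map (z : unit * pastType i) (v : T) : pastType i * T := (z.2, v).

Lemma measurable_step_map z : measurable_fun [set: T] (step_map z).
Proof. exact: measurable_fun_pair. Qed.

Definition step_kernel (z : unit * pastType i) : {measure set (pastType i * T) -> \bar R} :=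
  image_measure (Q (X i z.2)) (measurable_step_map z).

Definition lift_kernel (z : pastType i) : {measure set T -> \bar R} := Q (X i z).

Let measurable_lift_kernel U : measurable U ->
  measurable_fun [set: pastType i] (lift_kernel ^~ U).
Proof.
move=> mU; apply: (measurableT_comp (f := Q ^~ U)).
  exact: measurable_kernel.
exact: measurable_past.
Qed.

HB.instance Definition _ := isKernel.Build _ _ _ _ _ lift_kernel measurable_lift_kernel.

Let lift_kernel_prob z : lift_kernel z [set: T] = 1%E.
Proof. exact: prob_kernel. Qed.

HB.instance Definition _ := Kernel_isProbability.Build _ _ _ _ _ lift_kernel lift_kernel_prob.

Lemma step_kernelE z C : step_kernel z C = lift_kernel z.2 (xsection C z.2).
Proof. by rewrite /= /pushforward xsectionE. Qed.

Let measurable_step_kernel U : measurable U ->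
  measurable_fun [set: unit * pastType i] (step_kernel ^~ U).
Proof.
move=> mU; under eq_fun do rewrite step_kernelE.
apply: (measurableT_comp (f := fun z => lift_kernel z (xsection U z))) => //.
by apply: measurable_fun_xsection_finite_kernel; rewrite inE.
Qed.

HB.instance Definition _ := isKernel.Build _ _ _ _ _ step_kernel measurable_step_kernel.

Let step_kernel_prob z : step_kernel z setT = 1%E.
Proof. by rewrite step_kernelE xsectionE preimage_setT; exact: prob_kernel. Qed.

HB.instance Definition _ := Kernel_isProbability.Build _ _ _ _ _ step_kernel step_kernel_prob.

Definition past_law (u : unit) : {measure set pastType i -> \bar R} := image_measure P (@measurable_of_past i).

Let measurable_past_law U : measurable U -> measurable_fun [set: unit] (past_law ^~ U).
Proof. by move=> mU. Qed.

HB.instance Definition _ := isKernel.Build _ _ _ _ _ past_law measurable_past_law.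

Let past_law_prob z : past_law z setT = 1%E.
Proof. by rewrite /past_law /= /pushforward preimage_setT probability_setT. Qed.

HB.instance Definition _ := Kernel_isProbability.Build _ _ _ _ _ past_law past_law_prob.

Let path_map := fun w : Omega => (w : pastType i, X i.+1 w).
Let measurable_path_map : measurable_fun [set: Omega] path_map.
Proof. by apply: measurable_fun_pair => //; exact: measurable_of_past. Qed.

(** Both measures agree on rectangles by the Markov property, and the rectangles are stable under
    intersection and generate the product sigma-algebra. *)
Lemma path_law C : measurable C ->
  image_measure P measurable_path_map C = kcomp past_law step_kernel tt C.
Proof.
apply: (measure_unique [set A `*` B | A in measurable & B in measurable] (fun=> setT)).
- exact: measurable_prod_measurableType.
- move=> _ _ [A mA [B mB <-]] [A' mA' [B' mB' <-]].
  exists (A `&` A'); first exact: measurableI.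
  by exists (B `&` B'); [exact: measurableI|rewrite setXI].
- by move=> _; exists setT => //; exists setT => //; rewrite setXTT.
- by rewrite bigcup_const.
- move=> _ [A mA [B mB <-]].
  transitivity (P (A `&` X i.+1 @^-1` B)); first by [].
  rewrite (hX mA mB) integral_mkcond /kcomp [RHS]integral_image_measure//; last first.
    by apply: (measurableT_comp (measurable_kernel step_kernel _ _)) => //; exact: measurableX.
  apply: eq_integral => w _; rewrite step_kernelE/= patchE.
  by case: ifPn => wA; [rewrite in_xsectionX|rewrite notin_xsectionX// measure0].
- by move=> _; rewrite /= /pushforward preimage_setT probability_setT ltry.
Qed.

Lemma integral_path (h : pastType i * T -> \bar R) :
  (forall z, 0 <= h z)%E -> measurable_fun setT h ->
  (\int[P]_w h (w : pastType i, X i.+1 w) =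
   \int[P]_w \int[Q (X i w)]_y h (w : pastType i, y))%E.
Proof.
move=> h0 mh.
transitivity (\int[image_measure P measurable_path_map]_z h z)%E.
  by rewrite integral_image_measure.
rewrite (eq_measure_integral (kcomp past_law step_kernel tt)); last first.
  by move=> A mA _; exact: path_law.
rewrite integral_kcomp// integral_image_measure//; last 2 first.
- apply: (measurable_fun_integral_kernel (l := fun z => step_kernel (tt, z))) => // U mU.
  by apply: (measurableT_comp (measurable_kernel step_kernel _ mU)).
- by move=> *; exact: integral_ge0.
by apply: eq_integral => w _; exact: integral_image_measure.
Qed.

End step_kernel.

(** Induction on the number of steps: the last factor integrates to at most 1 under [Q (X n w)], and
    the other factors are functions of the past. *)
Lemma expectation_prod_le1 (g : T * T -> R) : measurable_fun setT g ->
  (forall z, 0 <= g z) -> (forall x, \int[Q x]_y (g (x, y))%:E <= 1)%E ->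
  forall n, (\int[P]_w (\prod_(i < n) g (X i w, X i.+1 w))%:E <= 1)%E.
Proof.
move=> mg g0 g1; elim=> [|n IHn].
  under eq_integral do rewrite big_ord0.
  by rewrite integral_cst// mul1e probability_le1.
pose past_prod (w : pastType n) := \prod_(i < n) g (X i w, X i.+1 w).
have mpast : measurable_fun setT past_prod.
  apply: measurable_prod => i _; apply: (measurableT_comp mg).
  apply: measurable_fun_pair; apply: measurable_past => //; exact: ltnW.
have past_ge0 w : 0 <= past_prod w by apply: prodr_ge0.
pose h (z : pastType n * T) := ((past_prod z.1)%:E * (g (X n z.1, z.2))%:E)%E.
have mgn : measurable_fun setT (fun z : pastType n * T => g (X n z.1, z.2)).
  apply: (measurableT_comp mg); apply: measurable_fun_pair => //.
  by apply: measurableT_comp => //; exact: measurable_past.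
have mh : measurable_fun setT h.
  apply: emeasurable_funM; apply/measurable_EFinP => //.
  exact: measurableT_comp.
have h0 z : (0 <= h z)%E by rewrite mule_ge0 ?lee_fin.
have -> : (\int[P]_w (\prod_(i < n.+1) g (X i w, X i.+1 w))%:E =
   \int[P]_w h (w : pastType n, X n.+1 w))%E.
  by apply: eq_integral => w _; rewrite big_ord_recr EFinM.
rewrite integral_path// (le_trans _ IHn)//.
have mprod : measurable_fun [set: Omega] (fun w => (past_prod w)%:E).
  apply/measurable_EFinP.
  exact: (measurableT_comp mpast (@measurable_of_past n)).
apply: ge0_le_integral => //.
- by move=> w _; exact: integral_ge0.
- apply: (measurableT_comp
    (f := fun w : pastType n => \int[lift_kernel w]_y h (w, y))%E); last first.
    exact: measurable_of_past.
  exact: (measurable_fun_integral_finite_kernel h (@lift_kernel n)).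
- move=> w _; rewrite /h /= ge0_integralZl//=; last 3 first.
  + by apply/measurable_EFinP; apply: measurableT_comp => //; exact: measurable_fun_pair.
  + by move=> y _; rewrite lee_fin.
  + by rewrite lee_fin past_ge0.
  by rewrite -[leRHS]mule1 lee_wpmul2l// lee_fin past_ge0.
Qed.

End markov_integral.

(** * Exponential supermartingales *)

Section exponential_mixtures.
Context {R : realType} {dT} {T : measurableType dT} (Q : R.-pker T ~> T) (n : nat).
Implicit Types (x : nat -> T) (J U : set (T * T)) (l : seq (R * set (T * T))).

Definition hits x J : R := \sum_(i < n) \1_J (x i, x i.+1).

(** Written with the kernel; the density enters only through [massE]. *)
Definition compensator x J : R := \sum_(i < n) fine (Q (x i) (xsection J (x i))).

Definition tilt (lam : R) x J : R :=
  expR (lam * hits x J - (expR lam - 1) * compensator x J).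

(** [pairwise] looks at positions, so a non-empty set cannot occur twice, even with two different
    exponents. *)
Definition disjoint_cubes l : Prop :=
  pairwise (fun p q => `[< p.2 `&` q.2 = set0 >]) l.

(** At most one of the disjoint sets contains [z], so the exponential is affine in the indicators
    and can be integrated exactly against [Q]. *)
Lemma expR_sum_indic l (z : T * T) : disjoint_cubes l ->
  expR (\sum_(q <- l) q.1 * \1_q.2 z) = 1 + \sum_(q <- l) (expR q.1 - 1) * \1_q.2 z.
Proof.
elim: l => [|q l IHl]; first by rewrite !big_nil expR0 addr0.
rewrite /disjoint_cubes /= => /andP[/allP ql dl]; rewrite !big_cons.
have [zq|zq] := pselect (q.2 z); last first.
  by rewrite indicE memNset// !mulr0 !add0r IHl.
have l0 (F : R -> R) : \sum_(p <- l) F p.1 * \1_p.2 z = 0.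
  apply: big1_seq => p /andP[_ pl]; have /asboolP dqp := ql _ pl.
  rewrite indicE memNset ?mulr0// => zp.
  by have : (q.2 `&` p.2) z by []; rewrite dqp.
rewrite (l0 id) (l0 (fun r => expR r - 1)) indicE mem_set//= !mulr1 !addr0.
by rewrite addrC subrK.
Qed.

(** The share of a single transition in a product of tilts; [prod_tilt_steps] thus reaches the form
    required by [expectation_prod_le1]. *)
Definition tilt_step l (z : T * T) : R :=
  expR (\sum_(q <- l) (q.1 * \1_q.2 z - (expR q.1 - 1) * fine (Q z.1 (xsection q.2 z.1)))).

Lemma prod_tilt_steps l x :
  \prod_(q <- l) tilt q.1 x q.2 = \prod_(i < n) tilt_step l (x i, x i.+1).
Proof.
rewrite -!expR_sum; congr expR; rewrite exchange_big /=; apply: eq_bigr => q _.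
by rewrite sumrB -!mulr_sumr.
Qed.

Lemma integrable_kernel_indic a (A : set T) : measurable A ->
  (Q a).-integrable setT (fun y => (\1_A y)%:E).
Proof.
move=> mA; apply/integrableP; split; first exact/measurable_EFinP.
under eq_integral do rewrite gee0_abs ?lee_fin//.
rewrite integral_indic// setIT.
apply: (@le_lt_trans _ _ 1%E); last exact: ltry.
by rewrite -(prob_kernel (s := Q) a) le_measure ?inE.
Qed.

(** The step is exp (- c) times an affine function of the indicators whose integral is 1 + c, and 1
    + c <= exp c. *)
Lemma integral_tilt_step_le1 l a : disjoint_cubes l ->
  (forall q, q \in l -> measurable q.2) ->
  (\int[Q a]_y (tilt_step l (a, y))%:E <= 1)%E.
Proof.
move=> dl ml.
pose c := \sum_(q <- l) (expR q.1 - 1) * fine (Q a (xsection q.2 a)).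
have stepE y : tilt_step l (a, y) =
    expR (- c) * (1 + \sum_(q <- l) (expR q.1 - 1) * \1_q.2 (a, y)).
  by rewrite -expR_sum_indic// -expRD addrC -sumrB.
have key : (Q a).-integrable setT
      (fun y => (1 + \sum_(q <- l) (expR q.1 - 1) * \1_q.2 (a, y))%:E) /\
    (\int[Q a]_y (1 + \sum_(q <- l) (expR q.1 - 1) * \1_q.2 (a, y))%:E = (1 + c)%:E)%E.
  rewrite /c; elim: l ml {dl c stepE} => [|q l IHl] ml.
    have -> : (fun y => (1 + \sum_(q <- [::]) (expR q.1 - 1) * \1_q.2 (a, y))%:E) =
        cst 1%E :> (T -> \bar R) by apply/funext => y; rewrite big_nil addr0.
    rewrite big_nil addr0 integral_cst// mul1e prob_kernel; split => //.
    by have := integrable_kernel_indic a measurableT; rewrite indicT.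
  have [|il Il] := IHl; first by move=> p pl; apply: ml; rewrite inE pl orbT.
  have mq : measurable (xsection q.2 a).
    by apply: measurable_xsection; apply: ml; rewrite inE eqxx.
  have indE y : \1_q.2 (a, y) = \1_(xsection q.2 a) y :> R.
    by rewrite !indicE mem_xsection.
  have iq : (Q a).-integrable setT (fun y => ((expR q.1 - 1) * \1_q.2 (a, y))%:E).
    under eq_fun do rewrite EFinM indE.
    apply: integrableZl => //; exact: integrable_kernel_indic.
  have eq1 y : ((1 + \sum_(p <- q :: l) (expR p.1 - 1) * \1_p.2 (a, y))%:E =
      ((expR q.1 - 1) * \1_q.2 (a, y))%:E +
      (1 + \sum_(p <- l) (expR p.1 - 1) * \1_p.2 (a, y))%:E)%E.
    by rewrite big_cons -EFinD addrCA.
  rewrite (funext eq1); split; first exact: integrableD.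
  rewrite integralD// Il big_cons.
  under eq_integral do rewrite indE EFinM.
  rewrite integralZl//; last exact: integrable_kernel_indic.
  rewrite integral_indic// setIT -[X in (_ * X)%E]fineK; last first.
    exact: finite_kernel_measure.
  by rewrite -EFinM -EFinD addrCA.
under eq_integral do rewrite stepE EFinM.
rewrite integralZl//; last exact: key.1.
rewrite key.2 -EFinM lee_fin -[leRHS](@expR0 R) -(addNr c) expRD.
by rewrite ler_wpM2l ?expR_ge0// expR_ge1Dx.
Qed.

(** [U] contains all the cubes involved: this is what makes the product of mixtures over disjoint
    [U] and [V] a mixture again. *)
Definition mixture U (Y : (nat -> T) -> R) : Prop :=
  exists s : seq (R * seq (R * set (T * T))),
  [/\ forall p, p \in s -> 0 <= p.1,
      \sum_(p <- s) p.1 <= 1,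
      forall p, p \in s -> disjoint_cubes p.2 /\
        forall q, q \in p.2 -> measurable q.2 /\ q.2 `<=` U
    & forall x, Y x = \sum_(p <- s) p.1 * \prod_(q <- p.2) tilt q.1 x q.2].

Lemma mixture1 : mixture set0 (fun=> 1).
Proof.
exists [:: (1, [::])]; split.
- by move=> p /[!inE] /eqP ->.
- by rewrite big_seq1.
- by move=> p /[!inE] /eqP ->; split; rewrite /disjoint_cubes.
- by move=> x; rewrite big_seq1 big_nil mulr1.
Qed.

(** Serves at depth 0 of [tree_weight], where half of the weight is dropped. *)
Lemma mixture0 U : mixture U (fun=> 0).
Proof.
exists [::]; split => //; first by rewrite big_nil.
by move=> x; rewrite big_nil.
Qed.

Lemma mixture_average J (G : seq R) : (0 < size G)%N -> measurable J ->
  mixture J (fun x => (size G)%:R^-1 * \sum_(lam <- G) tilt lam x J).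
Proof.
move=> G0 mJ; exists [seq ((size G)%:R^-1, [:: (lam, J)]) | lam <- G]; split.
- by move=> p /mapP[lam _ ->]; rewrite invr_ge0.
- by rewrite big_map big_const_seq count_predT iter_addr_0 -[X in X *+ _]mul1r -mulrnAl divff// pnatr_eq0 -lt0n.
- move=> p /mapP[lam _ ->]; split; first by rewrite /disjoint_cubes.
  by move=> q /=; rewrite inE => /eqP ->; split => /=.
- by move=> x; rewrite big_map mulr_sumr; apply: eq_bigr => lam _; rewrite big_seq1.
Qed.

Lemma mixture_half U Y Z : mixture U Y -> mixture U Z ->
  mixture U (fun x => 2^-1 * Y x + 2^-1 * Z x).
Proof.
move=> [s [s0 s1 sd sE]] [t [t0 t1 td tE]].
exists ([seq (2^-1 * p.1, p.2) | p <- s] ++ [seq (2^-1 * p.1, p.2) | p <- t]); split.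
- by move=> p; rewrite mem_cat => /orP[|] /mapP[q qs ->]; rewrite mulr_ge0//; [exact: s0|exact: t0].
- by rewrite big_cat !big_map/= -!mulr_sumr; lra.
- by move=> p; rewrite mem_cat => /orP[|] /mapP[q qs ->] /=; [exact: sd|exact: td].
- move=> x; rewrite sE tE big_cat !big_map !mulr_sumr /=.
  by congr (_ + _); apply: eq_bigr => p _; rewrite mulrA.
Qed.

(** Weights multiply and lists are concatenated; the new total weight is a product of two numbers of
    [0, 1]. *)
Lemma mixture_mul U V Y Z : U `&` V = set0 -> mixture U Y -> mixture V Z ->
  mixture (U `|` V) (fun x => Y x * Z x).
Proof.
move=> UV [s [s0 s1 sd sE]] [t [t0 t1 td tE]].
exists [seq (p.1 * q.1, p.2 ++ q.2) | p <- s, q <- t]; split.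
- by move=> p /allpairsP[[p1 p2]/= [p1s p2t ->]]; rewrite mulr_ge0//; [exact: s0|exact: t0].
- rewrite big_allpairs_dep/=; under eq_bigr do rewrite -mulr_sumr.
  rewrite -mulr_suml mulr_ile1// big_seq sumr_ge0// => *; by [apply: s0|apply: t0].
- move=> _ /allpairsP[[p1 p2]/= [p1s p2t ->]] /=.
  have [d1 h1] := sd _ p1s; have [d2 h2] := td _ p2t; split.
    rewrite /disjoint_cubes pairwise_cat; apply/and3P; split => //.
    apply/allrelP => q1 q2 q1p q2p; apply/asboolP.
    rewrite -subset0 -UV; apply: setISS; first exact: (h1 _ q1p).2.
    exact: (h2 _ q2p).2.
  move=> q; rewrite mem_cat => /orP[/h1[mq qU]|/h2[mq qV]]; split => //.
    exact: subset_trans (@subsetUl _ _ _).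
  exact: subset_trans (@subsetUr _ _ _).
- move=> x; rewrite sE tE big_allpairs_dep/= mulr_suml; apply: eq_bigr => p _.
  rewrite mulr_sumr; apply: eq_bigr => q _.
  by rewrite big_cat/= mulrACA.
Qed.

Lemma mixtureW U V Y : U `<=` V -> mixture U Y -> mixture V Y.
Proof.
move=> UV [s [s0 s1 sd sE]]; exists s; split => // p /sd[? h]; split => // q /h[? qU].
by split => //; exact: subset_trans UV.
Qed.

Lemma mixture_prod (ks : seq (set (T * T))) U (Y : set (T * T) -> (nat -> T) -> R) :
  pairwise (fun K K' => `[< K `&` K' = set0 >]) ks ->
  (forall K, K \in ks -> K `<=` U) ->
  (forall K, K \in ks -> mixture K (Y K)) ->
  mixture U (fun x => \prod_(K <- ks) Y K x).
Proof.
move=> dks kU hY.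
suff : mixture (\big[setU/set0]_(K <- ks) K) (fun x => \prod_(K <- ks) Y K x).
  by apply: mixtureW; rewrite -bigcup_seq; exact: bigcup_sub.
elim: ks dks hY {kU} => [_ _|K ks IHks /= /andP[/allP dK dks] hY].
  rewrite big_nil (_ : (fun x => _) = fun=> 1); first exact: mixture1.
  by apply/funext => x; rewrite big_nil.
rewrite big_cons (_ : (fun x => _) = fun x => Y K x * \prod_(K' <- ks) Y K' x); last first.
  by apply/funext => x; rewrite big_cons.
apply: mixture_mul; last 2 first.
- by apply: hY; rewrite inE eqxx.
- by apply: IHks => // K' K'ks; apply: hY; rewrite inE K'ks orbT.
rewrite big_distrr/=; apply: big1_seq => K' /= K'ks.
by apply/asboolP/dK.
Qed.

End exponential_mixtures.

(** * Mixtures evaluated along the chain *)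

Section mixture_expectation.
Context {dO} {Omega : measurableType dO} {R : realType} (P : probability Omega R).
Context {dT} {T : measurableType dT}.
Variables (X : nat -> {RV P >-> T}) (Q : R.-pker T ~> T) (n : nat).
Hypothesis hX : homogeneous_markov_chain X Q.

Let path w : nat -> T := fun i => X i w.

Lemma measurable_pair_path i : measurable_fun setT (fun w => (X i w, X i.+1 w)).
Proof. exact: measurable_fun_pair. Qed.

Lemma measurable_kernel_section (J : set (T * T)) : measurable J ->
  measurable_fun setT (fun x => fine (Q x (xsection J x))).
Proof.
move=> mJ; apply: measurableT_comp => //.
by apply: measurable_fun_xsection_finite_kernel; rewrite inE.
Qed.

Lemma measurable_tilt_step (l : seq (R * set (T * T))) :
  (forall q, q \in l -> measurable q.2) -> measurable_fun setT (tilt_step Q l).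
Proof.
move=> ml; apply: measurableT_comp => //.
elim: l ml => [|q l IHl] ml.
  by rewrite (_ : (fun z => _) = cst 0)//; apply/funext => z; rewrite big_nil.
under eq_fun do rewrite big_cons.
apply: measurable_funD; last by apply: IHl => p pl; apply: ml; rewrite inE pl orbT.
have mq : measurable q.2 by apply: ml; rewrite inE eqxx.
apply: measurable_funB; apply: measurable_funM => //.
exact: (measurableT_comp (measurable_kernel_section mq)).
Qed.

Lemma measurable_mixture U Y : mixture Q n U Y -> measurable_fun setT (Y \o path).
Proof.
move=> [s [s0 s1 sd YE]].
rewrite (_ : Y \o path = fun w => \sum_(p <- s) p.1 *
    \prod_(i < n) tilt_step Q p.2 (X i w, X i.+1 w)); last first.
  by apply/funext => w; rewrite /= YE; apply: eq_bigr => p _; rewrite prod_tilt_steps.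
elim: s sd {s0 s1 YE} => [|p s IHs] sd.
  by rewrite (_ : (fun z => _) = cst 0)//; apply/funext => z; rewrite big_nil.
under eq_fun do rewrite big_cons.
apply: measurable_funD; last by apply: IHs => q qs; apply: sd; rewrite inE qs orbT.
apply: measurable_funM => //; apply: measurable_prod => i _.
apply: (measurableT_comp (f := tilt_step Q p.2)); last exact: measurable_pair_path.
by apply: measurable_tilt_step => q qp; have [|_ /(_ _ qp)[]] := sd p; rewrite ?inE ?eqxx.
Qed.

(** By linearity it suffices to treat one product of tilts, which splits into transitions of
    conditional expectation at most 1. *)
Lemma expectation_mixture_le1 U Y : mixture Q n U Y ->
  (\int[P]_w (Y (path w))%:E <= 1)%E.
Proof.
move=> [s [s0 s1 sd YE]].
have mp p : p \in s -> measurable_fun setT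
    (fun w => \prod_(i < n) tilt_step Q p.2 (X i w, X i.+1 w)).
  move=> ps; apply: measurable_prod => i _.
  apply: (measurableT_comp (f := tilt_step Q p.2)); last exact: measurable_pair_path.
  by apply: measurable_tilt_step => q qp; have [_ /(_ _ qp)[]] := sd p ps.
suff -> : (\int[P]_w (Y (path w))%:E = \sum_(p <- s) p.1%:E *
    \int[P]_w (\prod_(i < n) tilt_step Q p.2 (X i w, X i.+1 w))%:E)%E.
  rewrite (@le_trans _ _ (\sum_(p <- s) p.1%:E)%E)//; last first.
    by rewrite sumEFin lee_fin.
  rewrite !big_seq; apply: lee_sum => p ps; rewrite -[leRHS]mule1.
  rewrite lee_wpmul2l// ?lee_fin ?s0//; apply: (expectation_prod_le1 hX).
  - by apply: measurable_tilt_step => q qp; have [_ /(_ _ qp)[]] := sd p ps.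
  - by move=> z; exact: expR_ge0.
  - move=> x; apply: integral_tilt_step_le1; have [? h] := sd p ps => // q /h[].
    by [].
rewrite (eq_integral (fun w => (\sum_(p <- s) p.1 *
    \prod_(i < n) tilt_step Q p.2 (X i w, X i.+1 w))%:E)); last first.
  by move=> w _; rewrite YE; congr EFin; apply: eq_bigr => p _; rewrite prod_tilt_steps.
elim: s mp s0 {s1 sd YE} => [|p s IHs] mp s0.
  rewrite big_nil; under eq_integral do rewrite big_nil.
  by rewrite integral0.
have mps q : q \in s -> measurable_fun setT
    (fun w => \prod_(i < n) tilt_step Q q.2 (X i w, X i.+1 w)).
  by move=> qs; apply: mp; rewrite inE qs orbT.
have s0' q : q \in s -> 0 <= q.1 by move=> qs; apply: s0; rewrite inE qs orbT.
have sum_ge0 w : 0 <= \sum_(q <- s) q.1 *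
    \prod_(i < n) tilt_step Q q.2 (X i w, X i.+1 w).
  rewrite big_seq sumr_ge0// => q qs; rewrite mulr_ge0 ?s0'// prodr_ge0// => *.
  exact: expR_ge0.
have prod0 (q : R * seq (R * set (T * T))) w :
    0 <= \prod_(i < n) tilt_step Q q.2 (X i w, X i.+1 w).
  by rewrite prodr_ge0// => *; exact: expR_ge0.
have msum : measurable_fun setT (fun w => \sum_(q <- s) q.1 *
    \prod_(i < n) tilt_step Q q.2 (X i w, X i.+1 w)).
  elim: s mps {mp s0 s0' IHs sum_ge0} => [|q s IHs] mps.
    by rewrite (_ : (fun z => _) = cst 0)//; apply/funext => z; rewrite big_nil.
  under eq_fun do rewrite big_cons.
  apply: measurable_funD; last by apply: IHs => q' qs; apply: mps; rewrite inE qs orbT.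
  by apply: measurable_funM => //; apply: mps; rewrite inE eqxx.
have p0 : 0 <= p.1 by apply: s0; rewrite inE eqxx.
rewrite big_cons -IHs//.
under eq_integral do rewrite big_cons EFinD EFinM.
rewrite ge0_integralD//; last 4 first.
- by move=> w _; rewrite mule_ge0// lee_fin.
- apply: measurable_funeM; apply/measurable_EFinP; apply: mp; by rewrite inE eqxx.
- by move=> w _; rewrite lee_fin.
- exact/measurable_EFinP.
rewrite ge0_integralZl//; last 2 first.
- by apply/measurable_EFinP; apply: mp; rewrite inE eqxx.
- by move=> w _; rewrite lee_fin.
Qed.

End mixture_expectation.

(** The bound is the pointwise supremum, and monotone convergence controls its integral. It merges
    the mixtures of all depths into one random variable, since the partitions have no common depth
    when l = oo. *)
Lemma monotone_bound {dO} {Omega : measurableType dO} {R : realType}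
    (P : {measure set Omega -> \bar R}) (Y : nat -> Omega -> R) (c : \bar R) :
  (forall k w, 0 <= Y k w) -> (forall k, measurable_fun setT (Y k)) ->
  (forall k w, Y k w <= Y k.+1 w) ->
  (forall k, \int[P]_w (Y k w)%:E <= c)%E ->
  exists B : Omega -> \bar R, [/\ measurable_fun setT B,
    forall w, (0 <= B w)%E, forall k w, ((Y k w)%:E <= B w)%E
    & (\int[P]_w B w <= c)%E].
Proof.
move=> Y0 mY ndY intY.
have nd w : {homo (fun k => (Y k w)%:E) : a b / (a <= b)%N >-> (a <= b)%E}.
  by apply: (homo_leq (@le_refl _ _)) => [? ? ? /le_trans|k]; [apply|rewrite lee_fin].
have cv w : ((Y k w)%:E @[k --> \oo] --> ereal_sup (range (fun k => (Y k w)%:E)))%E.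
  exact: ereal_nondecreasing_cvgn.
exists (fun w => ereal_sup (range (fun k => (Y k w)%:E))); split.
- apply: (emeasurable_fun_cvg (fun k w => (Y k w)%:E)) => //.
  by move=> k; exact/measurable_EFinP.
- by move=> w; apply: (@le_trans _ _ (Y 0 w)%:E); [rewrite lee_fin|apply: ereal_sup_ubound; exists 0].
- by move=> k w; apply: ereal_sup_ubound; exists k.
- have := @cvg_monotone_convergence _ _ _ P setT measurableT (fun k w => (Y k w)%:E).
  rewrite (_ : (fun x => limn _) = (fun w => ereal_sup (range (fun k => (Y k w)%:E)))); last first.
    by apply/funext => w; apply/cvg_lim => //; exact: cv.
  move=> cvi; apply: (cvge_le (F := \oo) _ (cvi _ _ _)) => //.
  + exact: nearW.
  + by move=> k; exact/measurable_EFinP.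
  + by move=> k w _; rewrite lee_fin.
Qed.

(** * Dyadic cubes *)

Section dyadic_index.
Context {R : realType}.
Implicit Types (u v : R) (j k : nat).

(* The last interval [I_j(2^j)] is closed, hence the minimum. *)
Definition dyadic_index j u : nat := minn (Num.truncn (u * 2 ^+ j)) (2 ^ j).-1.

(** The index is determined by its lower bounds, so this equivalence handles the integer part and
    the cap at the last interval together. *)
Lemma dyadic_index_ge j u k : 0 <= u ->
  (k <= dyadic_index j u)%N = (k < 2 ^ j)%N && (k%:R <= u * 2 ^+ j).
Proof.
move=> u0; have p0 : (0 < 2 ^ j)%N by rewrite expn_gt0.
by rewrite leq_min truncn_ge_nat ?mulr_ge0 ?exprn_ge0// -ltnS prednK// andbC.
Qed.

Lemma dyadic_index_lt j u : (dyadic_index j u < 2 ^ j)%N.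
Proof.
have p0 : (0 < 2 ^ j)%N by rewrite expn_gt0.
by rewrite -[ltnRHS]prednK// ltnS geq_minr.
Qed.

Lemma dyadic_index_half j u : 0 <= u -> dyadic_index j u = (dyadic_index j.+1 u)./2.
Proof.
move=> u0; apply/eqP; rewrite eqn_leq; apply/andP; split; [rewrite geq_half_double|].
  have := leqnn (dyadic_index j u); rewrite {1}dyadic_index_ge// => /andP[h1 h2].
  rewrite dyadic_index_ge// expnS mul2n ltn_double h1 /= exprS mulrCA.
  by rewrite -mul2n natrM ler_pM2l.
have := leqnn (dyadic_index j.+1 u)./2; rewrite geq_half_double.
rewrite dyadic_index_ge// expnS mul2n ltn_double exprS mulrCA => /andP[h1].
by rewrite -mul2n natrM ler_pM2l// dyadic_index_ge// h1.
Qed.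

Lemma dyadic_index_frac j k : (k < 2 ^ j)%N -> dyadic_index j (k%:R / 2 ^+ j) = k.
Proof.
move=> kj; have p0 : 0 < 2 ^+ j :> R by rewrite exprn_gt0.
have k0 : 0 <= k%:R / 2 ^+ j :> R by rewrite divr_ge0// ltW.
apply/eqP; rewrite eqn_leq; apply/andP; split.
  rewrite leqNgt dyadic_index_ge// divfK ?gt_eqF// ler_nat.
  by rewrite negb_and ltnn orbT.
by rewrite dyadic_index_ge// kj divfK ?gt_eqF /=.
Qed.

Lemma dyadic_index_le i j u v : 0 <= u -> 0 <= v -> (i <= j)%N ->
  dyadic_index j u = dyadic_index j v -> dyadic_index i u = dyadic_index i v.
Proof.
move=> u0 v0 /subnK <-; elim: (j - i)%N => // k IHk.
by rewrite addSn => e; apply: IHk; rewrite !(dyadic_index_half (k + i))// e.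
Qed.

(** Intervals are numbered from 1 and indices from 0, whence the successor. *)
Lemma dyadic_intervalP j l u : (1 <= l <= 2 ^ j)%N ->
  dyadic_interval j l u <-> 0 <= u <= 1 /\ (dyadic_index j u).+1 = l.
Proof.
move=> /andP[l1 lj]; have p0 : 0 < 2 ^+ j :> R by rewrite exprn_gt0.
have pE : (2 ^ j)%:R = 2 ^+ j :> R by rewrite natrX.
rewrite /dyadic_interval; case: ltnP => lj'; rewrite /= in_itv /=.
  rewrite ler_pdivrMr// ltr_pdivlMr//; split.
    move=> /andP[h1 h2]; have u0 : 0 <= u.
      by rewrite -(@pmulr_lge0 _ (2 ^+ j))// (le_trans _ h1).
    split.
      rewrite u0 -(@ler_pM2r _ (2 ^+ j))// mul1r (le_trans (ltW h2))//.
      by rewrite -pE ler_nat.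
    apply/eqP; rewrite eqn_leq; apply/andP; split.
      rewrite ltnNge dyadic_index_ge// negb_and; apply/orP; right.
      by rewrite -ltNge.
    have -> : l = l.-1.+1 by rewrite prednK.
    by rewrite ltnS dyadic_index_ge// h1 prednK// lj.
  move=> [/andP[u0 u1] el]; rewrite -{}el /= in lj' *.
  have := leqnn (dyadic_index j u); rewrite {1}dyadic_index_ge// => /andP[h1 ->] /=.
  rewrite ltNge; apply/negP => h2.
  have := ltnn (dyadic_index j u).
  by rewrite {1}dyadic_index_ge// h2 lj'.
have -> : l = (2 ^ j)%N by apply/eqP; rewrite eqn_leq lj.
have e2 : (2 ^ j).-1.+1 = (2 ^ j)%N by rewrite prednK// expn_gt0.
rewrite ler_pdivrMr//; split => [/andP[h1 h2]|[/andP[u0 ->]] h].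
  have u0 : 0 <= u by rewrite -(@pmulr_lge0 _ (2 ^+ j))// (le_trans _ h1).
  split; first by rewrite u0.
  apply/eqP; rewrite eqn_leq dyadic_index_lt -[X in (X <= _)%N]e2 ltnS.
  by rewrite dyadic_index_ge// h1 andbT ltn_predL expn_gt0.
have := leqnn (dyadic_index j u); rewrite {1}dyadic_index_ge// => /andP[_].
by rewrite -[in X in X -> _](_ : (dyadic_index j u).+1.-1 = dyadic_index j u)// h andbT.
Qed.

End dyadic_index.

Section dyadic_cubes_theory.
Context {R : realType} (d : nat).
Hypothesis d0 : (0 < d)%N.
Local Notation Z := (Rd R d * Rd R d)%type.
Implicit Types (z : Z) (K J : set Z) (j : nat).

(* [coord] alone denotes the coordinates of [vector]. *)
Local Notation coord := Defs.coord.

Definition point_of (g : 'I_(d + d) -> R) : Z :=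
  ([tuple g (lshift d i) | i < d], [tuple g (rshift d i) | i < d]).

Lemma coord_point_of g i : coord (point_of g) i = g i.
Proof.
rewrite /coord; case: (split_ordP i) => k ->.
  by rewrite tnth_lshift tnth_mktuple.
by rewrite tnth_rshift tnth_mktuple.
Qed.

Lemma measurable_coord i : measurable_fun setT (fun z : Z => coord z i).
Proof.
rewrite /coord; case: (split_ordP i) => k ->.
  under eq_fun do rewrite tnth_lshift.
  by apply: (measurableT_comp (f := fun t => tnth t k)); [exact: measurable_tnth|].
under eq_fun do rewrite tnth_rshift.
by apply: (measurableT_comp (f := fun t => tnth t k)); [exact: measurable_tnth|].
Qed.

(** Cubes are seen as classes of points with equal indices. Any point of a cube represents it
    ([cube_of_eq]), so nesting and disjointness become comparisons of indices. *)
Definition cube_of j z : set Z :=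
  [set z' | unit_square R d z' /\
            forall i, dyadic_index j (coord z' i) = dyadic_index j (coord z i)].

Lemma unit_square_ge0 z i : unit_square R d z -> 0 <= coord z i.
Proof. by move=> /(_ i)/andP[]. Qed.

Lemma cube_of_refl j z : unit_square R d z -> cube_of j z z.
Proof. by []. Qed.

Lemma cube_of_eq j z z' : cube_of j z z' -> cube_of j z = cube_of j z'.
Proof.
move=> [uz' e]; apply/seteqP; split => y [uy ey]; split => // i.
  by rewrite ey e.
by rewrite ey e.
Qed.

Lemma cube_of_le i j z : unit_square R d z -> (i <= j)%N -> cube_of j z `<=` cube_of i z.
Proof.
move=> uz ij y [uy e]; split => // k.
by apply: dyadic_index_le (e k) => //; exact: unit_square_ge0.
Qed.

Lemma frac_in01 j k : (k < 2 ^ j)%N -> 0 <= (k%:R / 2 ^+ j : R) <= 1.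
Proof.
move=> kj; have p0 : 0 < 2 ^+ j :> R by rewrite exprn_gt0.
by rewrite divr_ge0 ?(ltW p0)//= ler_pdivrMr// mul1r -natrX ler_nat ltnW.
Qed.

Lemma dyadic_cubesP j K :
  dyadic_cubes j K <-> exists2 z, unit_square R d z & K = cube_of j z.
Proof.
have KE (l : 'I_(d + d) -> nat) z : (forall i, (1 <= l i <= 2 ^ j)%N) ->
    (forall i, (dyadic_index j (coord z i)).+1 = l i) ->
    [set z | forall i, dyadic_interval j (l i) (coord z i)] = cube_of j z.
  move=> hl lz; apply/seteqP; split => y /= hy.
    split => i; have /dyadic_intervalP := hy i; case/(_ (hl i)) => // _.
    by rewrite -lz => -[].
  move=> i; apply/dyadic_intervalP => //; split; first exact: hy.1.
  by rewrite hy.2.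
split=> [[l hl ->]|[z uz ->]].
  have hl' i : ((l i).-1 < 2 ^ j)%N.
    by have /andP[l1 l2] := hl i; rewrite -ltnS prednK.
  exists (point_of (fun i => (l i).-1%:R / 2 ^+ j)).
    by move=> i; rewrite coord_point_of frac_in01.
  apply: KE => // i; rewrite coord_point_of dyadic_index_frac// prednK//.
  by have /andP[] := hl i.
exists (fun i => (dyadic_index j (coord z i)).+1); first by move=> i; rewrite dyadic_index_lt.
by rewrite (KE _ z)// => i; rewrite dyadic_index_lt.
Qed.

Lemma measurable_dyadic_cube j K : dyadic_cubes j K -> measurable K.
Proof.
move=> [l _ ->].
rewrite (_ : [set z | _] = \bigcap_(i in [set: 'I_(d + d)])
    (fun z : Z => coord z i) @^-1` dyadic_interval j (l i)); last first.
  by apply/seteqP; split => z /= h i => [_|]; exact: h.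
apply: fin_bigcap_measurable => // i _; rewrite -[X in measurable X]setTI.
by apply: measurable_coord => //; rewrite /dyadic_interval; case: ifP.
Qed.

(** Shows that a child is strictly smaller than its parent. The uniqueness of the level of a cube
    and the existence of two children both follow. *)
Lemma cube_of_split j z : unit_square R d z ->
  exists2 y, cube_of j z y & ~ cube_of j.+1 z y.
Proof.
move=> uz; have i0 : 'I_(d + d) by apply: (@Ordinal _ 0); rewrite addn_gt0 d0.
(* Each coordinate of [y b] has index 2 k + b at level [j.+1], where k is the index of that
   coordinate of [z] at level [j]. Both points lie in the cube of [z], and one of them leaves its
   child along [i0]. *)
pose y b := point_of (fun i => (b + (dyadic_index j (coord z i)).*2)%:R / 2 ^+ j.+1).
have ylt (b : bool) i : (b + (dyadic_index j (coord z i)).*2 < 2 ^ j.+1)%N.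
  have := dyadic_index_lt j (coord z i); rewrite expnS mul2n.
  by case: b => h; rewrite ?add1n ?add0n ?ltn_Sdouble// ltn_double.
have yi (b : bool) i : dyadic_index j.+1 (coord (y b) i) =
    (b + (dyadic_index j (coord z i)).*2)%N.
  by rewrite coord_point_of dyadic_index_frac.
have uy (b : bool) : unit_square R d (y b).
  by move=> i; rewrite coord_point_of frac_in01.
have yj (b : bool) : cube_of j z (y b).
  split => // i; rewrite dyadic_index_half ?unit_square_ge0// yi.
  by rewrite half_bit_double.
have [b hb] : exists b : bool, dyadic_index j.+1 (coord z i0) <>
    (b + (dyadic_index j (coord z i0)).*2)%N.
  have [e|e] := eqVneq (dyadic_index j.+1 (coord z i0)) (dyadic_index j (coord z i0)).*2.
    by exists true; rewrite e add1n => /n_Sn.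
  by exists false; rewrite add0n; exact/eqP.
by exists (y b) => // -[_ /(_ i0)]; rewrite yi => /esym.
Qed.

(** [children] quantifies over the level at which a set is a cube; this makes that level unique. If
    i < j, the whole cube would lie in one of its own children. *)
Lemma cube_of_level i j z z' : unit_square R d z -> unit_square R d z' ->
  cube_of i z = cube_of j z' -> i = j.
Proof.
wlog ij : i j z z' / (i <= j)%N => [h uz uz' e|uz uz' e].
  case: (leqP i j) => [ij|/ltnW ji]; first exact: (h _ _ z z').
  by apply/esym; exact: (h _ _ z' z).
have zz' : cube_of j z' z by rewrite -e.
move: ij; rewrite leq_eqVlt => /orP[/eqP//|ij].
have [y yi []] := cube_of_split i uz.
by apply: (cube_of_le uz ij); rewrite -(cube_of_eq zz') -e.
Qed.

Lemma children_cube_of j z : unit_square R d z ->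
  children (cube_of j z) = [set cube_of j.+1 y | y in cube_of j z].
Proof.
move=> uz; apply/seteqP; split => K /=.
  move=> [i [/dyadic_cubesP[y uy e] /dyadic_cubesP[y' uy' ->] sub]].
  have ij := cube_of_level uz uy e; rewrite -ij in sub *.
  by exists y' => //; exact: sub.
move=> [y jy <-]; have uy : unit_square R d y by case: jy.
exists j; split.
- by apply/dyadic_cubesP; exists z.
- by apply/dyadic_cubesP; exists y.
- by rewrite (cube_of_eq jy); exact: cube_of_le.
Qed.

Lemma finite_cubes j (A : set Z) : finite_set [set cube_of j y | y in A].
Proof.
pose f (g : {ffun 'I_(d + d) -> 'I_(2 ^ j)}) := [set z : Z | unit_square R d z /\
            forall i, dyadic_index j (coord z i) = g i].
apply: (@sub_finite_set _ _ (range f)); last exact: finite_image.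
move=> _ [y _ <-]; exists [ffun i => Ordinal (dyadic_index_lt j (coord y i))] => //.
by apply/seteqP; split => z [uz e]; split => // i; have := e i; rewrite ffunE.
Qed.

Definition is_cube K : Prop := exists j, dyadic_cubes j K.

Definition kids K : seq (set Z) := fset_set (children K).

Lemma is_cubeP K : is_cube K <-> exists j z, unit_square R d z /\ K = cube_of j z.
Proof.
split=> [[j /dyadic_cubesP[z uz ->]]|[j [z [uz ->]]]]; first by exists j, z.
by exists j; apply/dyadic_cubesP; exists z.
Qed.

Lemma kidsE j z : unit_square R d z ->
  [set` kids (cube_of j z)] = [set cube_of j.+1 y | y in cube_of j z].
Proof. by move=> uz; rewrite /kids children_cube_of// fset_setK//; exact: finite_cubes. Qed.

Lemma mem_kids K : is_cube K -> [set` kids K] = children K.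
Proof.
by move=> /is_cubeP[j [z [uz ->]]]; rewrite kidsE// children_cube_of.
Qed.

Lemma kids_uniq K : uniq (kids K).
Proof. exact: fset_uniq. Qed.

Lemma cube_kid K c : is_cube K -> c \in kids K -> is_cube c.
Proof.
move=> Kc cK; have : [set` kids K] c by [].
by rewrite mem_kids// => -[j [_ ? _]]; exists j.+1.
Qed.

Lemma kid_sub K c : is_cube K -> c \in kids K -> c `<=` K.
Proof.
move=> Kc cK; have : [set` kids K] c by [].
by rewrite mem_kids// => -[j []].
Qed.

Lemma cube_neq0 K : is_cube K -> K !=set0.
Proof. by move=> /is_cubeP[j [z [uz ->]]]; exists z. Qed.

Lemma kids_disjoint K c c' : is_cube K -> c \in kids K -> c' \in kids K ->
  c `&` c' !=set0 -> c = c'.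
Proof.
move=> /is_cubeP[j [z [uz ->]]] cK c'K [y [cy c'y]].
have : [set` kids (cube_of j z)] c by []; have : [set` kids (cube_of j z)] c' by [].
rewrite kidsE// => -[y' _ e'] [y'' _ e'']; rewrite -e' -e'' in cy c'y *.
by rewrite (cube_of_eq cy) (cube_of_eq c'y).
Qed.

Lemma kids_cover K z : is_cube K -> K z -> exists2 c, c \in kids K & c z.
Proof.
move=> /is_cubeP[j [y [uy ->]]] yz; exists (cube_of j.+1 z); last first.
  by apply: cube_of_refl; case: yz.
suff : [set` kids (cube_of j y)] (cube_of j.+1 z) by [].
by rewrite kidsE//; exists z.
Qed.

(** Having two children is what pays for the weight 1/2 of a division in [tree_weight_partition]. *)
Lemma size_kids K : is_cube K -> (1 < size (kids K))%N.
Proof.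
move=> Kc; have /is_cubeP[j [z [uz KE]]] := Kc.
have Kz : K z by rewrite KE.
have [c cK cz] := kids_cover Kc Kz.
have [y] := cube_of_split j uz; rewrite -KE => Ky nzy.
have [c' c'K c'y] := kids_cover Kc Ky.
have cc' : c != c'.
  apply/eqP => e; apply: nzy; have : [set` kids K] c by [].
  rewrite KE kidsE// => -[x _ ex]; rewrite -ex in cz.
  by rewrite -(cube_of_eq cz) ex e.
have : uniq [:: c; c'] by rewrite /= inE cc'.
by move=> /(@uniq_leq_size _ [:: c; c'] (kids K)); apply => x; rewrite !inE => /orP[] /eqP ->.
Qed.

Lemma cube_nested K J : is_cube K -> is_cube J -> K `<=` J ->
  K = J \/ exists2 c, c \in kids J & K `<=` c.
Proof.
move=> /is_cubeP[i [z [uz ->]]] /is_cubeP[j [y [uy ->]]] sub.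
have yz : cube_of j y z by apply: sub.
have [ij|ji] := leqP i j.
  by left; apply/seteqP; split => //; rewrite (cube_of_eq yz); exact: cube_of_le.
right; exists (cube_of j.+1 z); last exact: cube_of_le.
suff : [set` kids (cube_of j y)] (cube_of j.+1 z) by [].
by rewrite kidsE//; exists z.
Qed.

Lemma cube_dichotomy K J : is_cube K -> is_cube J -> K `&` J !=set0 ->
  K `<=` J \/ J `<=` K.
Proof.
move=> /is_cubeP[i [z [uz ->]]] /is_cubeP[j [y [uy ->]]] [x [zx yx]].
rewrite (cube_of_eq zx) (cube_of_eq yx); have ux : unit_square R d x by case: zx.
by case: (leqP i j) => [|/ltnW] h; [right|left]; exact: cube_of_le.
Qed.

Lemma cube_sub_unit_square K : is_cube K -> K `<=` unit_square R d.
Proof. by move=> /is_cubeP[j [z [uz ->]]] y []. Qed.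

Lemma is_cube_unit_square : is_cube (unit_square R d).
Proof.
apply/is_cubeP; exists 0, (point_of (fun=> 0)); split.
  by move=> i; rewrite coord_point_of lexx ler01.
by apply/seteqP; split => [z uz|z []//]; split => // i; rewrite /dyadic_index !minn0.
Qed.

Lemma measurable_cube K : is_cube K -> measurable K.
Proof. by move=> [j]; exact: measurable_dyadic_cube. Qed.

End dyadic_cubes_theory.

(** * Dyadic partitions as trees *)

Section tree_partitions.
Context {R : realType} (d : nat).
Hypothesis d0 : (0 < d)%N.
Local Notation Z := (Rd R d * Rd R d)%type.
Implicit Types (z : Z) (J K : set Z) (s t : seq (set Z)) (k : nat).

(** Partitions are built from the root instead of by global steps, so that sums and products over
    them split over the children, as [tree_weight] does. *)
Fixpoint tree_partition k J s : Prop :=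
  s = [:: J] \/
  if k is k'.+1 then exists f : set Z -> seq (set Z),
    (forall c, c \in kids J -> tree_partition k' c (f c)) /\
    s = flatten [seq f c | c <- kids J]
  else False.

Lemma tree_partition1 k J : tree_partition k J [:: J].
Proof. by case: k => [|k]; left. Qed.

Lemma tree_partition_split k J (f : set Z -> seq (set Z)) :
  (forall c, c \in kids J -> tree_partition k c (f c)) ->
  tree_partition k.+1 J (flatten [seq f c | c <- kids J]).
Proof. by move=> hf; right; exists f. Qed.

Lemma tree_partition_ind (P : nat -> set Z -> seq (set Z) -> Prop) :
  (forall k J, is_cube J -> P k J [:: J]) ->
  (forall k J f, is_cube J ->
     (forall c, c \in kids J -> tree_partition k c (f c)) ->
     (forall c, c \in kids J -> P k c (f c)) ->
     P k.+1 J (flatten [seq f c | c <- kids J])) ->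
  forall k J s, is_cube J -> tree_partition k J s -> P k J s.
Proof.
move=> P1 PS; elim=> [|k IHk] J s cJ /=.
  by case=> // ->; exact: P1.
case=> [->|[f [hf ->]]]; first exact: P1.
by apply: PS => // c cJk; apply: IHk; [exact: (cube_kid d0 cJ cJk)|exact: hf].
Qed.

Arguments tree_partition : simpl never.

Lemma tree_partitionS k J s : is_cube J -> tree_partition k J s -> tree_partition k.+1 J s.
Proof.
move: k J s; apply: tree_partition_ind => [k J _|k J f _ _ h]; first exact: tree_partition1.
exact: tree_partition_split.
Qed.

Lemma tree_partition_cube k J s K : is_cube J -> tree_partition k J s -> K \in s ->
  is_cube K /\ K `<=` J.
Proof.
move=> cJ hs; move: k J s cJ hs K; apply: tree_partition_ind => [k J cJ K|k J f cJ _ IH K].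
  by rewrite inE => /eqP ->; split.
move=> /flatten_mapP[c cJk /(IH _ cJk)[cK Kc]]; split => //.
exact: subset_trans (kid_sub d0 cJ cJk).
Qed.

Lemma tree_partition_cover k J s z : is_cube J -> tree_partition k J s -> J z ->
  exists2 K, K \in s & K z.
Proof.
move=> cJ hs; move: k J s cJ hs z; apply: tree_partition_ind => [k J cJ z Jz|k J f cJ _ IH z Jz].
  by exists J => //; rewrite inE.
have [c cJk cz] := kids_cover d0 cJ Jz.
have [K Kc Kz] := IH _ cJk _ cz; exists K => //.
by apply/flatten_mapP; exists c.
Qed.

Lemma tree_partition_neq0 k J s : is_cube J -> tree_partition k J s -> (0 < size s)%N.
Proof.
move=> cJ hs; have [z Jz] := cube_neq0 cJ.
by have [K] := tree_partition_cover cJ hs Jz; case: s {hs}.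
Qed.

Lemma tree_partition_disjoint k J s K K' : is_cube J -> tree_partition k J s ->
  K \in s -> K' \in s -> K `&` K' !=set0 -> K = K'.
Proof.
move=> cJ hs; move: k J s cJ hs K K'; apply: tree_partition_ind => [k J cJ K K'|k J f cJ hf IH K K'].
  by rewrite !inE => -> ->.
move=> /flatten_mapP[c cJk Kc] /flatten_mapP[c' cJk' Kc'] [z [Kz K'z]].
have cc' : c = c'.
  apply: (kids_disjoint d0 cJ cJk cJk'); exists z; split.
    by apply: (tree_partition_cube (cube_kid d0 cJ cJk) (hf _ cJk) Kc).2.
  by apply: (tree_partition_cube (cube_kid d0 cJ cJk') (hf _ cJk') Kc').2.
by apply: (IH c cJk) => //; [rewrite cc'|exists z].
Qed.

Lemma tree_partition_uniq k J s : is_cube J -> tree_partition k J s -> uniq s.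
Proof.
move: k J s; apply: tree_partition_ind => [//|k J f cJ hf IH].
have : {subset kids J <= kids J} by [].
have := kids_uniq J.
(* The induction runs over a sublist of [kids J], while the hypotheses on [f] keep referring to the
   full list. *)
elim: {-3}(kids J) => // c cs IHcs /= /andP[ncs ucs] sub.
have cJk : c \in kids J by apply: sub; rewrite inE eqxx.
rewrite cat_uniq IH//= IHcs//; last by move=> x xs; apply: sub; rewrite inE xs orbT.
rewrite andbT; apply/hasPn => K /flatten_mapP[c' c'cs Kc']; apply/negP => Kc.
have c'J : c' \in kids J by apply: sub; rewrite inE c'cs orbT.
have [cK Ksub] := tree_partition_cube (cube_kid d0 cJ cJk) (hf _ cJk) Kc.
have [_ Ksub'] := tree_partition_cube (cube_kid d0 cJ c'J) (hf _ c'J) Kc'.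
have [z Kz] := cube_neq0 cK.
have e : c = c' by apply: (kids_disjoint d0 cJ cJk c'J); exists z; split; [exact: Ksub|exact: Ksub'].
by rewrite e c'cs in ncs.
Qed.

Lemma indic_tree_partition k J s z : is_cube J -> tree_partition k J s ->
  \1_J z = \sum_(K <- s) \1_K z :> R.
Proof.
move=> cJ hs; have [Jz|Jz] := pselect (J z); last first.
  rewrite indicE memNset// big1_seq// => K /andP[_ Ks]; rewrite indicE memNset// => Kz.
  by apply/Jz/(tree_partition_cube cJ hs Ks).2.
have [K Ks Kz] := tree_partition_cover cJ hs Jz.
rewrite (bigD1_seq K)//=; last exact: tree_partition_uniq hs.
rewrite !indicE !mem_set// big1_seq ?addr0// => K' /andP[K'K K's].
rewrite indicE memNset// => K'z.
have := tree_partition_disjoint cJ hs K's Ks; rewrite (_ : (K' = K) = False).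
  by apply; exists z.
by apply/propext; split => // e; rewrite e eqxx in K'K.
Qed.

Definition refine_seq (D : set Z -> bool) s : seq (set Z) :=
  flatten [seq if D K then kids K else [:: K] | K <- s].

(** Dividing leaves commutes with the passage to the children. This translates [refines_in_one_step]
    into the recursion from the root. *)
Lemma tree_partition_refine D k J s : is_cube J -> tree_partition k J s ->
  tree_partition k.+1 J (refine_seq D s).
Proof.
move: k J s; apply: tree_partition_ind => [k J cJ|k J f cJ hf IH].
  rewrite /refine_seq /= cats0; case: ifP => _; last exact: tree_partition1.
  rewrite -[kids J](_ : flatten [seq [:: c] | c <- kids J] = _); last first.
    by elim: (kids J) => //= c cs ->.
  by apply: tree_partition_split => c _; exact: tree_partition1.
rewrite (_ : refine_seq D _ = flatten [seq refine_seq D (f c) | c <- kids J]).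
  exact: tree_partition_split.
rewrite /refine_seq; elim: (kids J) => //= c cs IHcs.
by rewrite map_cat flatten_cat IHcs.
Qed.

Lemma tree_partition_after k m : partitions_after k m ->
  exists2 s, tree_partition k (unit_square R d) s & m = [set` s].
Proof.
elim: k m => [m ->|k IHk m /= [m' /IHk[s hs ->] [D Ds ->]]].
  exists [:: unit_square R d]; first exact: tree_partition1.
  by apply/seteqP; split => K /=; rewrite inE => /eqP.
have cU : is_cube (unit_square R d) := is_cube_unit_square d.
exists (refine_seq (fun K => `[< D K >]) s); first exact: tree_partition_refine.
have cs K : K \in s -> is_cube K by move=> Ks; have [] := tree_partition_cube cU hs Ks.
apply/seteqP; split => K /=.
  case=> [[Ks DK]|[K' DK' K'K]]; apply/flatten_mapP.
    by exists K => //; case: asboolP => // _; rewrite inE.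
  exists K'; first exact: Ds.
  case: asboolP => // _; suff : [set` kids K'] K by [].
  by rewrite (mem_kids d0)//; apply: cs; exact: Ds.
move=> /flatten_mapP[K' K's]; case: asboolP => DK'.
  move=> KK'; right; exists K' => //; rewrite -(mem_kids d0)//; exact: cs.
by rewrite inE => /eqP ->; left.
Qed.

Lemma tree_partitionP (l : option nat) m : partitions l m ->
  exists k s, tree_partition k (unit_square R d) s /\ m = [set` s].
Proof.
have h l' : partitions_le l' m -> exists k s,
    tree_partition k (unit_square R d) s /\ m = [set` s].
  by move=> [k _ /tree_partition_after[s]]; exists k, s.
by case: l => [l|[l _]]; exact: h.
Qed.

Definition join_seq s K : seq (set Z) :=
  [seq K' `&` K | K' <- s & `[< K `&` K' !=set0 >]].

Lemma join_cubeE s K : join_cube [set` s] K = [set` join_seq s K].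
Proof.
apply/seteqP; split => J /=.
  move=> [K' [K's KK'] <-]; apply/mapP; exists K' => //.
  by rewrite mem_filter; apply/andP; split => //; apply/asboolP.
move=> /mapP[K']; rewrite mem_filter => /andP[/asboolP KK' K's] ->.
by exists K'.
Qed.

(** Descent from [J] to [K]: as long as [K] lies in a child, only the cubes below that child meet
    [K]; once [K] is reached, all the cubes are kept. Bounds uniform over the partitions of [K]
    therefore apply to [join_cube]. *)
Lemma tree_partition_join k J s K : is_cube J -> tree_partition k J s ->
  is_cube K -> K `<=` J -> tree_partition k K (join_seq s K).
Proof.
move=> cJ hs; move: k J s cJ hs K; apply: tree_partition_ind => [k J cJ K cK KJ|k J f cJ hf IH K cK KJ].
  rewrite /join_seq /= asboolT; last by rewrite setIidl//; exact: cube_neq0.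
  by rewrite /= setIidr//; exact: tree_partition1.
have [->|[c cJk Kc]] := cube_nested d0 cK cJ KJ.
  rewrite (_ : join_seq _ J = flatten [seq f c | c <- kids J]); first exact: tree_partition_split.
  have fJ K' : K' \in flatten [seq f c | c <- kids J] -> is_cube K' /\ K' `<=` J.
    exact: (tree_partition_cube cJ (tree_partition_split hf)).
  rewrite /join_seq; elim: (flatten _) fJ => //= K' s IHs fJ.
  have [cK' K'J] : is_cube K' /\ K' `<=` J by apply: fJ; rewrite inE eqxx.
  rewrite asboolT/=; last by rewrite setIidr//; exact: cube_neq0.
  by rewrite setIidl// IHs// => x xs; apply: fJ; rewrite inE xs orbT.
rewrite (_ : join_seq _ K = join_seq (f c) K).
  by apply: tree_partitionS => //; exact: IH.
have join_cat s1 s2 : join_seq (s1 ++ s2) K = join_seq s1 K ++ join_seq s2 K.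
  by rewrite /join_seq filter_cat map_cat.
have join0 c' : c' \in kids J -> c' != c -> join_seq (f c') K = [::].
  move=> c'J c'c; rewrite /join_seq.
  suff -> : [seq K' <- f c' | `[< K `&` K' !=set0 >]] = [::] by [].
  apply/eqP; rewrite -(negbK (_ == _)) -has_filter; apply/hasPn => K' K'f.
  apply/asboolP => -[z [Kz K'z]]; case/eqP: c'c.
  apply: (kids_disjoint d0 cJ c'J cJk); exists z; split; last exact: Kc.
  by apply: (tree_partition_cube (cube_kid d0 cJ c'J) (hf _ c'J) K'f).2.
have : {subset kids J <= kids J} by [].
have := kids_uniq J; move: cJk.
elim: {-4}(kids J) => // c' cs IHcs; rewrite inE /= join_cat => ccs /andP[c'cs ucs] sub.
have subcs : {subset cs <= kids J} by move=> x xs; apply: sub; rewrite inE xs orbT.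
have c'J : c' \in kids J by apply: sub; rewrite inE eqxx.
(* Only [c] contributes, and it occurs once in the list. *)
have [e|c'c] := eqVneq c' c.
  rewrite e (_ : join_seq (flatten _) K = [::]) ?cats0//.
  rewrite {}e in c'cs; elim: cs c'cs {IHcs ccs ucs sub} subcs => //= x cs IHcs.
  rewrite inE negb_or => /andP[cx ccs] subcs.
  rewrite join_cat join0 ?IHcs//; last by rewrite eq_sym.
    by move=> y ycs; apply: subcs; rewrite inE ycs orbT.
  by apply: subcs; rewrite inE eqxx.
rewrite join0//= IHcs//; by move: ccs; rewrite eq_sym (negbTE c'c).
Qed.

End tree_partitions.

(** * Mixtures over dyadic partitions *)

Section tree_weights.
Context {R : realType} (d : nat).
Hypothesis d0 : (0 < d)%N.
Local Notation Z := (Rd R d * Rd R d)%type.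
Implicit Types (J K : set Z) (s t : seq (set Z)) (k : nat) (A : set Z -> R).

(* Sums over the dyadic partitions of depth at most k, each weighted by a power of 1/2,
   of the product of [A] over their cubes. *)
Fixpoint tree_weight A k J : R :=
  if k is k'.+1 then 2^-1 * A J + 2^-1 * \prod_(c <- kids J) tree_weight A k' c
  else 2^-1 * A J.

Lemma tree_weight_ge A k J : (forall K, 0 < A K) -> 2^-1 * A J <= tree_weight A k J.
Proof.
move=> A0; elim: k J => [|k IHk] J //=.
rewrite lerDl mulr_ge0// prodr_ge0// => c _.
by rewrite (le_trans _ (IHk c))// mulr_ge0// ltW.
Qed.

Lemma tree_weight_gt0 A k J : (forall K, 0 < A K) -> 0 < tree_weight A k J.
Proof. by move=> A0; rewrite (lt_le_trans _ (tree_weight_ge k J A0))// mulr_gt0. Qed.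

Lemma tree_weightS A k J : (forall K, 0 < A K) -> tree_weight A k J <= tree_weight A k.+1 J.
Proof.
move=> A0; elim: k J => [|k IHk] J /=.
  rewrite lerDl mulr_ge0// prodr_ge0// => c _.
  by rewrite mulr_ge0// ltW.
rewrite lerD2l ler_pM2l//; apply: ler_prod => c _.
by rewrite IHk ltW// tree_weight_gt0.
Qed.

Lemma tree_weight_le A i k J : (forall K, 0 < A K) -> (i <= k)%N ->
  tree_weight A i J <= tree_weight A k J.
Proof.
move=> A0 /subnK <-; elim: (k - i)%N => // j IHj.
by rewrite addSn (le_trans IHj)// tree_weightS.
Qed.

(** Each cube of [s] costs a factor 1/4. The leading 4 closes the induction: with q >= 2 children, 4
    ^ q / 2 >= 4. *)
Lemma tree_weight_partition A i k J s : (forall K, 0 < A K) ->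
  is_cube J -> tree_partition k J s ->
  4 * \prod_(K <- s) (tree_weight A i K / 4) <= tree_weight A (k + i) J.
Proof.
move=> A0 cJ hs; move: k J s cJ hs; apply: (tree_partition_ind d0) => [k J cJ|k J f cJ hf IH].
  by rewrite big_seq1 mulrCA divff// mulr1 tree_weight_le// leq_addl.
rewrite addSn /=.
have p0 c : 0 <= \prod_(K <- f c) (tree_weight A i K / 4).
  by rewrite prodr_ge0// => K _; rewrite divr_ge0// ltW// tree_weight_gt0.
apply: (@le_trans _ _ (2^-1 * \prod_(c <- kids J) (4 * \prod_(K <- f c) (tree_weight A i K / 4)))).
  rewrite big_flatten big_map/= [X in _ <= _ * X]big_split/=.
  rewrite big_const_seq count_predT iter_mulr_1 [leRHS]mulrA ler_wpM2r//.
    by apply: prodr_ge0.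
  have := size_kids d0 cJ; case: (size _) => // -[//|m] _.
  have : 1 <= 4 ^+ m :> R by rewrite exprn_ege1// ler1n.
  by rewrite !exprS; lra.
apply: ler_wpDl; first by rewrite mulr_ge0// ltW.
rewrite ler_pM2l// big_seq [leRHS]big_seq; apply: ler_prod => c cJk.
by rewrite mulr_ge0//= IH.
Qed.

Lemma ln_prod (T : eqType) (s : seq T) (F : T -> R) : (forall x, 0 < F x) ->
  ln (\prod_(x <- s) F x) = \sum_(x <- s) ln (F x).
Proof.
move=> F0; elim: s => [|x s IHs]; first by rewrite !big_nil ln1.
by rewrite !big_cons lnM ?IHs// posrE// prodr_gt0.
Qed.

(** For non-decreasing sequences, two indices can be replaced by their maximum, so the suprema taken
    separately at each point still satisfy the bound on the sum. *)
Lemma sum_sup_monotone (T : eqType) (s : seq T) (a : nat -> T -> R) (B : R) :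
  (forall k x, a k x <= a k.+1 x) -> uniq s ->
  (forall k, \sum_(x <- s) a k x <= B) ->
  exists b : T -> R, (forall k x, x \in s -> a k x <= b x) /\ \sum_(x <- s) b x <= B.
Proof.
move=> aS; have a_le i k x : (i <= k)%N -> a i x <= a k x.
  move=> /subnK <-; elim: (k - i)%N => // j IHj.
  by rewrite addSn (le_trans IHj).
elim: s B => [|x s IHs] B /=.
  by move=> _ /(_ 0); rewrite big_nil => B0; exists (fun=> 0); rewrite big_nil.
move=> /andP[xs us] h.
have hub k : a k x <= B - \sum_(y <- s) a 0 y.
  rewrite lerBrDr (le_trans _ (h k))// big_cons lerD2l; apply: ler_sum => y _.
  exact: a_le.
pose S := sup (range (fun k => a k x)).
have hS : has_sup (range (fun k => a k x)).
  split; first by exists (a 0 x), 0.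
  by exists (B - \sum_(y <- s) a 0 y) => _ [k _ <-].
have [k|b [hb sb]] := IHs (B - S) us.
  rewrite lerBrDr addrC -lerBrDr; apply: sup_le_ub; first exact: hS.1.
  move=> _ [i _ <-]; rewrite lerBrDr (le_trans _ (h (maxn i k)))// big_cons.
  by rewrite lerD ?a_le ?leq_maxl//; apply: ler_sum => y _; rewrite a_le// leq_maxr.
exists (fun y => if y == x then S else b y); split.
  move=> k y; rewrite inE => /orP[/eqP ->|ys].
    by rewrite eqxx; apply: sup_upper_bound => //; exists k.
  by case: eqP => [e|_]; [rewrite -e ys in xs|exact: hb].
rewrite big_cons eqxx -lerBrDl (le_trans _ sb)// le_eqVlt; apply/orP; left; apply/eqP.
by apply: eq_big_seq => y ys; case: eqP => // e; rewrite -e ys in xs.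
Qed.

(** [b K] is a supremum over depths of the logarithms of [tree_weight A i K], which dominate all the
    partitions of [K]. The 8 is 2 times 4: the weight 1/2 at depth 0 and the 1/4 per cube of
    [tree_weight_partition]. *)
Lemma tree_weight_ln_bound A (B : R) k J s : (forall K, 0 < A K) ->
  is_cube J -> (forall i, tree_weight A i J <= B) -> tree_partition k J s ->
  exists b : set Z -> R,
    (forall K i t, K \in s -> tree_partition i K t ->
       \sum_(K' <- t) (ln (A K') - ln 8) <= b K) /\
    \sum_(K <- s) b K <= ln B + (size s)%:R * ln 4.
Proof.
move=> A0 cJ hB hs.
have ln4 : 0 <= ln 4 :> R by rewrite ln_ge0// ler1n.
have W0 i K : 0 < tree_weight A i K / 4 by rewrite divr_gt0// tree_weight_gt0.
have lnB i : \sum_(K <- s) ln (tree_weight A i K) <= ln B + (size s)%:R * ln 4.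
  have := tree_weight_partition i A0 cJ hs => /le_trans/(_ (hB _)).
  have P0 : 0 < \prod_(K <- s) (tree_weight A i K / 4) by rewrite prodr_gt0.
  rewrite -(@ler_ln _ (4 * _)) ?posrE ?mulr_gt0//; last first.
    by rewrite (lt_le_trans _ (hB 0))// tree_weight_gt0.
  rewrite lnM ?posrE// ln_prod//.
  under eq_bigr do rewrite ln_div ?posrE ?tree_weight_gt0//.
  rewrite sumrB big_const_seq count_predT iter_addr_0 -(mulr_natl (ln 4)).
  by move: ln4; lra.
have [b [hb sb]] := @sum_sup_monotone _ s (fun i K => ln (tree_weight A i K)) _
  (fun i K => ltac:(by rewrite ler_ln ?posrE ?tree_weight_gt0 ?tree_weightS))
  (tree_partition_uniq d0 cJ hs) lnB.
exists b; split=> // K i t Ks ht; apply: le_trans (hb (i + 0)%N K Ks).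
have [cK _] := tree_partition_cube d0 cJ hs Ks.
have := tree_weight_partition 0 A0 cK ht.
have P0 : 0 < \prod_(K <- t) (tree_weight A 0 K / 4) by rewrite prodr_gt0.
rewrite -ler_ln ?posrE ?mulr_gt0 ?tree_weight_gt0// lnM ?posrE// ln_prod// => h.
apply: le_trans h; rewrite ler_wpDl// le_eqVlt; apply/orP; left; apply/eqP.
apply: eq_bigr => K' _ /=; rewrite -ln_div ?posrE//; congr ln.
by lra.
Qed.

Lemma mixture_tree_weight (Q : R.-pker (Rd R d) ~> (Rd R d)) n (G : seq R) k J :
  (0 < size G)%N -> is_cube J ->
  mixture Q n J (fun x => tree_weight
    (fun K => (size G)%:R^-1 * \sum_(lam <- G) tilt Q n lam x K) k J).
Proof.
move=> G0; elim: k J => [|k IHk] J cJ.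
  have := mixture_half (mixture_average Q n G0 (measurable_cube cJ)) (mixture0 Q n J).
  by congr (mixture _ _ _ _); apply/funext => x; rewrite mulr0 addr0.
apply: mixture_half; first exact: mixture_average (measurable_cube cJ).
apply: mixture_prod.
- have : {subset kids J <= kids J} by [].
  elim: {-3}(kids J) (kids_uniq J) => //= c s IHs /andP[cs us] sub.
  rewrite IHs// ?andbT; last by move=> x xs; apply: sub; rewrite inE xs orbT.
  apply/allP => c' c's; apply/asboolP; apply: contrapT => /eqP/set0P ne.
  have e : c = c'.
    by apply: (kids_disjoint d0 cJ) => //; apply: sub; rewrite inE ?eqxx ?c's ?orbT.
  by rewrite e c's in cs.
- by move=> c; exact: kid_sub.
- by move=> c cJk; apply: IHk; exact: cube_kid cJk.
Qed.

End tree_weights.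

(** * Scalar inequalities *)

Section scalar_bounds.
Context {R : realType}.

(** From 1 - l <= exp (- l) one gets exp l <= 1 / (1 - l), and (1 + l + 2 l^2)(1 - l) = 1 + l^2 (1 -
    2 l). *)
Lemma expR_le_quadratic (l : R) : l <= 2^-1 -> expR l <= 1 + l + 2 * l ^+ 2.
Proof.
move=> l2; have h : 0 < 1 - l by lra.
have e0 : 0 < expR (- l) by exact: expR_gt0.
have e1 : 1 - l <= expR (- l) by have := expR_ge1Dx (- l); lra.
rewrite -[l in leLHS]opprK expRN.
rewrite (le_trans (y := (1 - l)^-1))//; first by rewrite lef_pV2.
rewrite -[leLHS]mul1r ler_pdivrMr//.
have : 0 <= l ^+ 2 * (1 - 2 * l) by rewrite mulr_ge0 ?sqr_ge0//; lra.
by lra.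
Qed.

(** Spacing 1/(2n) on [-1/2, 1/2]: fine enough to lose a bounded amount when S <= n, and with few
    enough points for averaging to cost only ln (2n + 1). *)
Definition grid n : seq R := [seq (k%:R - n%:R) / (2 * n%:R) | k <- iota 0 (n.*2).+1].

Lemma size_grid n : size (grid n) = (n.*2).+1.
Proof. by rewrite size_map size_iota. Qed.

Lemma grid_near n (l : R) : (0 < n)%N -> `|l| <= 2^-1 ->
  exists2 l', l' \in grid n & `|l' - l| <= (2 * n%:R)^-1 /\ `|l'| <= 2^-1.
Proof.
move=> n0; rewrite ler_norml => /andP[l1 l2].
have n0' : 0 < n%:R :> R by rewrite ltr0n.
have n2 : 0 < 2 * n%:R :> R by rewrite mulr_gt0.
pose v := 2 * n%:R * l + n%:R.
have v0 : 0 <= v.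
  have : 0 <= 2 * n%:R * (l + 2^-1) by rewrite mulr_ge0 ?(ltW n2)//; lra.
  by rewrite /v; lra.
have v2 : v <= (n.*2)%:R.
  have : 0 <= 2 * n%:R * (2^-1 - l) by rewrite mulr_ge0 ?(ltW n2)//; lra.
  by rewrite /v -mul2n natrM; lra.
have /andP[t1 t2] := truncn_itv v0.
have tn : (Num.truncn v <= n.*2)%N.
  by rewrite -(ler_nat R) (le_trans t1).
set k := Num.truncn v in t1 t2 tn *.
exists ((k%:R - n%:R) / (2 * n%:R)).
  by apply/mapP; exists k => //; rewrite mem_iota add0n /= ltnS.
have lE : l = (v - n%:R) / (2 * n%:R).
  by rewrite /v addrK mulrC mulKf// gt_eqF.
have k2 : k%:R <= 2 * n%:R :> R by rewrite -natrM ler_nat mul2n.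
have k0 : 0 <= k%:R :> R by [].
split.
  rewrite [X in _ - X]lE -mulrBl normrM (ger0_norm (x := (2 * n%:R)^-1)) ?invr_ge0 ?(ltW n2)//.
  rewrite -[leRHS]mul1r ler_pM2r ?invr_gt0//.
  by rewrite ler_norml; move: t2; rewrite -natr1 => t2; apply/andP; split; lra.
rewrite normrM (ger0_norm (x := (2 * n%:R)^-1)) ?invr_ge0 ?(ltW n2)//.
by rewrite ler_pdivrMr// ler_norml; apply/andP; split; lra.
Qed.

(** The exponent is at least l (N - S) - 2 l^2 S, maximal at l = (N - S)/(4 S) with value (N - S)^2
    / (8 S), which is at least (sqrt N - sqrt S)^2 / 8. This l is in [-1/2, 1/2] when N <= 3 S, and
    rounding it to the grid loses at most 1 because S <= n. *)
Lemma sqrt_diff_le_grid n (N S : R) : (0 < n)%N -> 0 <= N -> 0 <= S <= n%:R ->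
  exists2 l, l \in grid n &
    (Num.sqrt N - Num.sqrt S) ^+ 2 <= 8 * (l * N - (expR l - 1) * S) + 8.
Proof.
move=> n0 N0 /andP[S0 Sn].
have n0' : 1 <= n%:R :> R by rewrite ler1n.
have vN := sqr_sqrtr N0; have wS := sqr_sqrtr S0.
have v0 := sqrtr_ge0 N; have w0 := sqrtr_ge0 S.
set v := Num.sqrt N in vN v0 *; set w := Num.sqrt S in wS w0 *.
have expS l : l <= 2^-1 -> l * (N - S) - 2 * l ^+ 2 * S <= l * N - (expR l - 1) * S.
  move=> l2; have := ler_wpM2r S0 (expR_le_quadratic l2); lra.
have [NS|NS] := leP N (3 * S); last first.
  (* Here N > 3 S, and the end point 1/2 of the grid already gives N / 2 - S >= N / 6. *)
  exists 2^-1.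
    apply/mapP; exists n.*2; first by rewrite mem_iota /= ltnS.
    rewrite -mul2n natrM (_ : 2 * n%:R - n%:R = n%:R); last by lra.
    by rewrite invfM mulrCA mulfV ?mulr1// gt_eqF// (lt_le_trans _ n0').
  have h : (v - w) ^+ 2 <= N.
    have wv : w <= v by rewrite ler_sqrt//; lra.
    by rewrite -vN ler_sqr ?nnegrE ?subr_ge0//; lra.
  by have := expS 2^-1 (lexx _); lra.
have [S00|S00] := eqVneq S 0.
  have N00 : N = 0 by apply/eqP; rewrite eq_le N0 andbT; move: NS; rewrite S00; lra.
  exists 0.
    apply/mapP; exists n; first by rewrite mem_iota /= ltnS -addnn leq_addr.
    by rewrite subrr mul0r.
  by rewrite /v /w N00 S00 subrr expr0n /=; lra.
have Sp : 0 < S by rewrite lt_neqAle eq_sym S00.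
have [|l lg [ll l2]] := @grid_near n ((N - S) / (4 * S)) n0.
  rewrite normrM (ger0_norm (x := (4 * S)^-1)) ?invr_ge0; last by lra.
  by rewrite ler_pdivrMr ?ler_norml; [apply/andP; split|]; lra.
exists l => //.
have l2' : l <= 2^-1 by move: l2; rewrite ler_norml => /andP[].
have q : (l - (N - S) / (4 * S)) ^+ 2 * (2 * S) <= 1.
  have : (l - (N - S) / (4 * S)) ^+ 2 <= ((2 * n%:R)^-1) ^+ 2.
    by rewrite -[leLHS]real_normK ?num_real// ler_sqr ?nnegrE// invr_ge0; lra.
  have S2 : 0 <= 2 * S by lra.
  move=> /(ler_wpM2r S2)/le_trans; apply.
  rewrite exprVn mulrC ler_pdivrMr ?mul1r; last by rewrite exprn_gt0//; lra.
  have : S * 1 <= n%:R * n%:R by apply: ler_pM.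
  by lra.
have e : l * (N - S) - 2 * l ^+ 2 * S =
    (N - S) ^+ 2 / (8 * S) - (l - (N - S) / (4 * S)) ^+ 2 * (2 * S) by field.
have dS : (v - w) ^+ 2 <= (N - S) ^+ 2 / S.
  rewrite ler_pdivlMr// -{1}wS -{}vN -{}wS.
  have : 0 <= (v - w) ^+ 2 * (v * (v + 2 * w)).
    by rewrite mulr_ge0 ?sqr_ge0// mulr_ge0//; lra.
  by lra.
have e8 : (N - S) ^+ 2 / (8 * S) = ((N - S) ^+ 2 / S) / 8 by field.
by have := expS l l2'; rewrite e e8; lra.
Qed.

End scalar_bounds.

(** * Quadratic inequalities for the test on one cube *)

Section gain_bound.
Context {R : realFieldType}.
Implicit Types N S C M v w kappa x y rho psi : R.

(* [S], [C] and [M] stand for the integrals over a cube of [u ^+ 2], [u] and [1], where [u]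
   is the square root of the transition density. *)
Definition sq_dist S C M (c : R) : R := S - 2 * c * C + c ^+ 2 * M.

(** The difference of the two sides is [sq_dist] at 2 y - x. Here and below, positivity of [sq_dist]
    at a well-chosen point replaces a pointwise inequality in u. *)
Lemma sq_dist_triangle S C M x y : (forall c, 0 <= sq_dist S C M c) ->
  sq_dist S C M x <= 2 * sq_dist S C M y + 2 * ((x - y) ^+ 2 * M).
Proof.
by move=> /(_ (2 * y - x)) h; rewrite -subr_ge0; move: h; rewrite /sq_dist; lra.
Qed.

Lemma sq_dist_sub S C M x y : (forall c, 0 <= sq_dist S C M c) ->
  (x - y) ^+ 2 * M <= 2 * sq_dist S C M x + 2 * sq_dist S C M y.
Proof.
by move=> /(_ ((x + y) / 2)) h; rewrite -subr_ge0; move: h; rewrite /sq_dist; lra.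
Qed.

(* Baraud's inequality, which holds pointwise in [u]. *)
Lemma affinity_test_le S C M kappa x y rho psi :
  0 <= C -> (forall c, 0 <= sq_dist S C M c) -> 0 <= kappa -> kappa ^+ 2 = 2^-1 ->
  0 <= x -> 0 <= y -> 0 <= rho -> rho ^+ 2 = x ^+ 2 + y ^+ 2 -> y - x = psi * rho ->
  psi ^+ 2 <= 1 ->
  kappa / 2 * (rho * (y - x)) * M + kappa * psi * S + (x ^+ 2 - y ^+ 2) / 2 * M <=
  (1 + kappa) / 2 * sq_dist S C M x - (1 - kappa) / 2 * sq_dist S C M y.
Proof.
move=> C0 sq_dist_ge0 k0 k2 x0 y0 rho0 rho2 psirho psi1.
have e1 : y - x - psi * rho = 0 by rewrite psirho subrr.
have e2 : kappa ^+ 2 - 2^-1 = 0 by rewrite k2 subrr.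
have e3 : rho ^+ 2 - x ^+ 2 - y ^+ 2 = 0 by rewrite rho2; lra.
have psi_le1 : psi <= 1 by have := sqr_ge0 (psi - 1); lra.
have xy : x + y <= 2 * kappa * rho.
  rewrite -ler_sqr ?nnegrE ?addr_ge0 ?mulr_ge0// !exprMn k2 rho2.
  by have := sqr_ge0 (x - y); lra.
have h1 : 0 <= kappa * (1 - psi) * sq_dist S C M (rho * kappa).
  by rewrite mulr_ge0// mulr_ge0//; lra.
have h2 : 0 <= kappa * C * (2 * kappa * rho - x - y).
  by rewrite mulr_ge0 ?mulr_ge0//; lra.
rewrite -subr_ge0.
(* Two non-negative terms, where [rho * kappa] is the root of the mean of x^2 and y^2, plus
   multiples of the three relations that vanish; with these the equality is a rational identity. *)
rewrite (_ : _ - _ = kappa * (1 - psi) * sq_dist S C M (rho * kappa) +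
    kappa * C * (2 * kappa * rho - x - y) +
    ((y - x - psi * rho) * (C - kappa / 2 * rho * M)
    + (kappa ^+ 2 - 2^-1) * (- 2 * psi * rho * C - kappa * (1 - psi) * rho ^+ 2 * M)
    - kappa / 2 * (rho ^+ 2 - x ^+ 2 - y ^+ 2) * M)).
  by rewrite e1 e2 e3; lra.
by rewrite /sq_dist; field.
Qed.

(** Integrate u^2 = 2 (u - x)^2 + 2 x^2 - (u - 2 x)^2 and use psi^2 x^2 <= (x - y)^2. This lets the
    distances absorb the random error of the test. *)
Lemma psi2_le S C M x y rho psi : 0 <= M -> (forall c, 0 <= sq_dist S C M c) ->
  rho ^+ 2 = x ^+ 2 + y ^+ 2 -> y - x = psi * rho -> psi ^+ 2 <= 1 ->
  psi ^+ 2 * S <= 6 * sq_dist S C M x + 4 * sq_dist S C M y.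
Proof.
move=> M0 sq_dist_ge0 rho2 psirho psi1.
have px : psi ^+ 2 * x ^+ 2 <= (x - y) ^+ 2.
  have -> : (x - y) ^+ 2 = psi ^+ 2 * rho ^+ 2 by rewrite -exprMn -psirho; ring.
  by rewrite ler_wpM2l ?sqr_ge0// rho2 lerDl sqr_ge0.
have h1 := mulr_ge0 (sqr_ge0 psi) (sq_dist_ge0 (2 * x)).
have h2 := ler_wpM2r (sq_dist_ge0 x) psi1.
have h3 := ler_wpM2r M0 px.
have h4 := sq_dist_sub x y sq_dist_ge0.
by move: h1 h2 h3 h4; rewrite /sq_dist; lra.
Qed.

(** Baraud's inequality, plus the error kappa psi (N - S) with N - S = (v - w)^2 + 2 w (v - w). The
    weight 1/128 is chosen so that the terms at [y] disappear: 3/8 (1 - kappa) + 4/128 <= (1 -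
    kappa)/2, as kappa <= 3/4. *)
Lemma gain_le N S C M v w kappa x y rho psi :
  v ^+ 2 = N -> w ^+ 2 = S -> 0 <= C -> 0 <= M -> (forall c, 0 <= sq_dist S C M c) ->
  0 <= kappa -> kappa ^+ 2 = 2^-1 ->
  0 <= x -> 0 <= y -> 0 <= rho -> rho ^+ 2 = x ^+ 2 + y ^+ 2 -> y - x = psi * rho ->
  psi ^+ 2 <= 1 ->
  (1 - kappa) / 4 * (x - y) ^+ 2 * M +
  (kappa / 2 * (rho * (y - x)) * M + kappa * psi * N + (x ^+ 2 - y ^+ 2) / 2 * M) <=
  2 * sq_dist S C M x + 65 * (v - w) ^+ 2.
Proof.
move=> vN wS C0 M0 sq_dist_ge0 k0 k2 x0 y0 rho0 rho2 psirho psi1.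
have k34 : kappa <= 3 / 4.
  have k34' : 0 <= 3 / 4 :> R by lra.
  by rewrite -ler_sqr ?nnegrE// k2; lra.
have h1 := affinity_test_le C0 sq_dist_ge0 k0 k2 x0 y0 rho0 rho2 psirho psi1.
have h2 : (x - y) ^+ 2 * M <= 3 * sq_dist S C M x + 3 / 2 * sq_dist S C M y.
  rewrite -subr_ge0; have := sq_dist_ge0 ((2 * x + y) / 3).
  by rewrite /sq_dist; lra.
have h3 : kappa * psi * (N - S) <= 128^-1 * (psi ^+ 2 * S) + 65 * (v - w) ^+ 2.
  have kp : (kappa * psi) ^+ 2 <= 1.
    by rewrite exprMn k2; lra.
  have kp1 : kappa * psi <= 1 by have := sqr_ge0 (kappa * psi - 1); lra.
  have a1 := ler_wpM2r (sqr_ge0 (v - w)) kp1.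
  have a2 : 2 * (kappa * psi) * w * (v - w) <= 128^-1 * (psi ^+ 2 * w ^+ 2) + 64 * (v - w) ^+ 2.
    have := sqr_ge0 (psi * w - 128 * kappa * (v - w)).
    have e : kappa ^+ 2 * (v - w) ^+ 2 = 2^-1 * (v - w) ^+ 2 by rewrite k2.
    by move: e; lra.
  by rewrite -vN -wS; lra.
have h4 := psi2_le M0 sq_dist_ge0 rho2 psirho psi1.
have h5 := ler_wpM2l (_ : 0 <= (1 - kappa) / 4) h2.
have h6 : 0 <= (3 / 4 - kappa) * sq_dist S C M y by rewrite mulr_ge0//; lra.
have h7 : 0 <= kappa * sq_dist S C M x by rewrite mulr_ge0.
have := sq_dist_ge0 x; have := sq_dist_ge0 y.
have : 0 <= (1 - kappa) / 4 by lra.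
by move=> /h5; lra.
Qed.

End gain_bound.

Section histogram_bound.
Context {R : rcfType}.

(** Compare with b = sqrt (S / M). Its [sq_dist] is 2 S - 2 b C, and C / M <= b by Cauchy-Schwarz,
    so it is at most 2 (S - C^2 / M), twice the minimum over c. Passing from S to N costs the last
    term. *)
Lemma sq_dist_histogram (N S C M c : R) : 0 <= N -> 0 <= S -> 0 <= C -> 0 <= M ->
  (forall c, 0 <= sq_dist S C M c) ->
  sq_dist S C M (Num.sqrt (N / M)) <=
  4 * sq_dist S C M c + 2 * (Num.sqrt N - Num.sqrt S) ^+ 2.
Proof.
move=> N0 S0 C0 M0 sq_dist_ge0.
(* For M = 0, [sq_dist] is affine in c and non-negative, which forces C = 0. *)
have [M00|Mn0] := eqVneq M 0.
  have C00 : C = 0.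
    apply/eqP; rewrite eq_le C0 andbT leNgt; apply/negP => Cp.
    have := sq_dist_ge0 ((S + 1) / C); rewrite /sq_dist M00 mulr0 addr0.
    rewrite (_ : 2 * ((S + 1) / C) * C = 2 * (S + 1)); last by field; rewrite gt_eqF.
    by lra.
  rewrite /sq_dist M00 invr0 mulr0 sqrtr0 C00.
  have := sqr_ge0 (Num.sqrt N - Num.sqrt S); lra.
have Mp : 0 < M by rewrite lt_neqAle eq_sym Mn0.
set x := Num.sqrt (N / M); set b := Num.sqrt (S / M).
have b0 : 0 <= b := sqrtr_ge0 _.
have bM : b ^+ 2 * M = S by rewrite sqr_sqrtr ?divr_ge0// divfK.
have e1 : (x - b) ^+ 2 * M = (Num.sqrt N - Num.sqrt S) ^+ 2.
  rewrite /x /b !sqrtrM// -mulrBl exprMn sqr_sqrtr ?invr_ge0// mulfVK//.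
have h1 := sq_dist_triangle x b sq_dist_ge0.
suff h2 : sq_dist S C M b <= 2 * sq_dist S C M c by lra.
have h3 := sq_dist_ge0 (C / M).
have rb : C / M <= b.
  rewrite -ler_sqr ?nnegrE ?divr_ge0//.
  rewrite -(@ler_pM2r _ M)// bM.
  move: h3; rewrite /sq_dist.
  rewrite (_ : 2 * (C / M) * C = 2 * ((C / M) ^+ 2 * M)); last by field.
  by lra.
have h4 := mulr_ge0 C0 (_ : 0 <= b - C / M).
have h5 := mulr_ge0 M0 (sqr_ge0 (c - C / M)).
have e2 : M * (c - C / M) ^+ 2 = c ^+ 2 * M - 2 * c * C + C * (C / M) by field.
have : 0 <= b - C / M by lra.
move=> /h4; rewrite /sq_dist bM; move: h5; rewrite e2; lra.
Qed.

End histogram_bound.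

(** * Distance and test on a path *)

Section path_functionals.
Context {R : realType} (d : nat).
Hypothesis d0 : (0 < d)%N.
Local Notation Z := (Rd R d * Rd R d)%type.
Variables (mu : {measure set (Rd R d) -> \bar R}) (Q : R.-pker (Rd R d) ~> (Rd R d)).
Variable s : Z -> R.
Hypothesis hmu : mu (unit_cube R d) = 1%E.
Hypothesis hs : transition_density mu Q s.
Implicit Types (J K : set Z) (a : Rd R d) (f g : Z -> R).

(** Asked at every [a], so that [path_integral] is linear on such functions whatever the path. *)
Definition sections_integrable f := forall a, mu.-integrable setT (fun y => (f (a, y))%:E).

Lemma measurable_unit_cube : measurable (unit_cube R d).
Proof.
rewrite (_ : unit_cube R d = \bigcap_(i in [set: 'I_d])
    (fun t : Rd R d => tnth t i) @^-1` `[0, 1]); last first.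
  apply/seteqP; split => t /= h i => [_|]; rewrite /= ?in_itv/=; first exact: h.
  by have := h i I; rewrite /= in_itv.
apply: fin_bigcap_measurable => // i _; rewrite -[X in measurable X]setTI.
by apply: measurable_tnth.
Qed.

Lemma xsection_cube_sub J a : is_cube J -> xsection J a `<=` unit_cube R d.
Proof.
move=> cJ y; rewrite /xsection /= inE => /(cube_sub_unit_square cJ) h i.
by have := h (rshift d i); rewrite /Defs.coord tnth_rshift.
Qed.

Lemma measurable_cube_section J a : is_cube J -> measurable (xsection J a).
Proof. by move=> cJ; apply: measurable_xsection; exact: measurable_cube. Qed.

Lemma indic_cube_section J a y : \1_J (a, y) = \1_(xsection J a) y :> R.
Proof. by rewrite !indicE mem_xsection. Qed.

Lemma sections_integrable_indic J : is_cube J -> sections_integrable \1_J.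
Proof.
move=> cJ a; under eq_fun do rewrite indic_cube_section.
have mJ := measurable_cube_section a cJ.
apply/integrableP; split; first exact/measurable_EFinP.
under eq_integral do rewrite gee0_abs ?lee_fin//.
rewrite integral_indic// setIT; apply: (@le_lt_trans _ _ 1%E); last exact: ltry.
rewrite -hmu le_measure ?inE//; last exact: xsection_cube_sub.
exact: measurable_unit_cube.
Qed.

Lemma measurable_density_section a : measurable_fun setT (fun y => s (a, y)).
Proof.
by case: hs => ms _ _; apply: (measurableT_comp ms); exact: measurable_fun_pair.
Qed.

Lemma density_ge0 z : 0 <= s z.
Proof. by case: hs. Qed.

Lemma integral_density_cube J a : is_cube J ->
  (\int[mu]_y (s (a, y) * \1_J (a, y))%:E = Q a (xsection J a))%E.
Proof.
move=> cJ; case: hs => _ _ ->; last exact: measurable_cube_section.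
rewrite [RHS]integral_mkcond; apply: eq_integral => y _.
rewrite patchE indic_cube_section indicE; case: ifPn => _.
  by rewrite mulr1.
by rewrite mulr0.
Qed.

Lemma sections_integrable_density J : is_cube J ->
  sections_integrable (fun z => s z * \1_J z).
Proof.
move=> cJ a; apply/integrableP; split.
  apply/measurable_EFinP; apply: measurable_funM.
    exact: measurable_density_section.
  under eq_fun do rewrite indic_cube_section.
  by apply: measurable_indic; exact: measurable_cube_section.
under eq_integral do rewrite gee0_abs ?lee_fin ?mulr_ge0 ?density_ge0//.
rewrite integral_density_cube//.
apply: (@le_lt_trans _ _ 1%E); last exact: ltry.
rewrite -(prob_kernel (s := Q) a) le_measure ?inE//.
exact: measurable_cube_section.
Qed.

Lemma sections_integrableD f g : sections_integrable f -> sections_integrable g ->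
  sections_integrable (fun z => f z + g z).
Proof.
move=> fi gi a; under eq_fun do rewrite EFinD.
exact: integrableD (fi a) (gi a).
Qed.

Lemma sections_integrableZ c f : sections_integrable f ->
  sections_integrable (fun z => c * f z).
Proof. by move=> fi a; under eq_fun do rewrite EFinM; exact: integrableZl (fi a). Qed.

(** Domination by 1 + s on the cube, whose sections have measure at most 1. *)
Lemma sections_integrable_sqrt J : is_cube J ->
  sections_integrable (fun z => Num.sqrt (s z) * \1_J z).
Proof.
move=> cJ a.
apply: (le_integrable measurableT _ _
  (sections_integrableD (sections_integrable_indic cJ) (sections_integrable_density cJ) a)).
  apply/measurable_EFinP; apply: measurable_funM.
    have msqrt : measurable_fun setT (@Num.sqrt R).
      by apply: continuous_measurable_fun; exact: sqrt_continuous.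
    exact: (measurableT_comp msqrt (measurable_density_section a)).
  under eq_fun do rewrite indic_cube_section.
  by apply: measurable_indic; exact: measurable_cube_section.
move=> y _ /=; rewrite lee_fin !ger0_norm ?addr_ge0 ?mulr_ge0 ?density_ge0//.
rewrite -[X in _ <= X + _]mul1r -mulrDl ler_wpM2r//.
have := sqr_sqrtr (density_ge0 (a, y)).
have := density_ge0 (a, y).
by have := sqr_ge0 (Num.sqrt (s (a, y)) - 1); lra.
Qed.

Variables (n : nat) (x : nat -> Rd R d).

Definition path_integral f : R := \sum_(i < n) \int[mu]_y f (x i, y).

Lemma path_integralD f g : sections_integrable f -> sections_integrable g ->
  path_integral (fun z => f z + g z) = path_integral f + path_integral g.
Proof.
move=> fi gi; rewrite -big_split; apply: eq_bigr => i _.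
by rewrite RintegralD//; [exact: fi|exact: gi].
Qed.

Lemma path_integralZ c f : sections_integrable f ->
  path_integral (fun z => c * f z) = c * path_integral f.
Proof.
move=> fi; rewrite mulr_sumr; apply: eq_bigr => i _.
by rewrite RintegralZl//; exact: fi.
Qed.

Lemma path_integral_sum (T : eqType) (r : seq T) (F : T -> Z -> R) :
  (forall t, t \in r -> sections_integrable (F t)) ->
  path_integral (fun z => \sum_(t <- r) F t z) = \sum_(t <- r) path_integral (F t) /\
  sections_integrable (fun z => \sum_(t <- r) F t z).
Proof.
elim: r => [|t r IHr] hF.
  split.
    rewrite big_nil /path_integral big1// => i _.
    under eq_Rintegral do rewrite big_nil.
    by rewrite Rintegral_cst// mul0r.
  by move=> a; under eq_fun do rewrite big_nil; exact: integrable0.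
have hr : forall t, t \in r -> sections_integrable (F t).
  by move=> u ur; apply: hF; rewrite inE ur orbT.
have ht : sections_integrable (F t) by apply: hF; rewrite inE eqxx.
have [e ir] := IHr hr.
have -> : (fun z => \sum_(u <- t :: r) F u z) = (fun z => F t z + \sum_(u <- r) F u z).
  by apply/funext => z; rewrite big_cons.
by rewrite path_integralD// e big_cons; split => //; exact: sections_integrableD.
Qed.

Lemma path_integral_ge0 f : (forall z, 0 <= f z) -> 0 <= path_integral f.
Proof. by move=> f0; apply: sumr_ge0 => i _; apply: Rintegral_ge0 => y _. Qed.

(** [volume], [sqrt_mass] and [mass] play the roles of M, C and S in [sq_dist]; [lossE] recovers the
    integral behind [loss]. *)
Definition volume J : R := path_integral \1_J.
Definition sqrt_mass J : R := path_integral (fun z => Num.sqrt (s z) * \1_J z).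
Definition mass J : R := compensator Q n x J.
Definition loss J (c : R) : R := sq_dist (mass J) (sqrt_mass J) (volume J) c.

Lemma massE J : is_cube J -> mass J = path_integral (fun z => s z * \1_J z).
Proof.
move=> cJ; apply: eq_bigr => i _; rewrite /Rintegral.
by rewrite integral_density_cube.
Qed.

Lemma volume_ge0 J : 0 <= volume J.
Proof. by apply: path_integral_ge0. Qed.

Lemma sqrt_mass_ge0 J : 0 <= sqrt_mass J.
Proof. by apply: path_integral_ge0 => z; rewrite mulr_ge0. Qed.

Lemma mass_ge0 J : 0 <= mass J.
Proof. by apply: sumr_ge0 => i _; exact: fine_ge0. Qed.

Lemma mass_le J : is_cube J -> mass J <= n%:R.
Proof.
move=> cJ; rewrite -[n in leRHS](card_ord n) -sum1_card natr_sum; apply: ler_sum => i _.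
rewrite -lee_fin fineK; last exact: finite_kernel_measure (measurable_cube_section _ cJ).
rewrite -(prob_kernel (s := Q) (x i)) le_measure ?inE//.
exact: measurable_cube_section.
Qed.

Lemma lossE J c : is_cube J ->
  path_integral (fun z => (Num.sqrt (s z) - c) ^+ 2 * \1_J z) = loss J c /\
  sections_integrable (fun z => (Num.sqrt (s z) - c) ^+ 2 * \1_J z).
Proof.
move=> cJ.
have -> : (fun z => (Num.sqrt (s z) - c) ^+ 2 * \1_J z) =
    (fun z => s z * \1_J z + (- (2 * c) * (Num.sqrt (s z) * \1_J z) + c ^+ 2 * \1_J z)).
  apply/funext => z; have := sqr_sqrtr (density_ge0 z).
  by set q := Num.sqrt _ => <-; ring.
have i1 := sections_integrable_density cJ.
have i2 := sections_integrableZ (- (2 * c)) (sections_integrable_sqrt cJ).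
have i3 := sections_integrableZ (c ^+ 2) (sections_integrable_indic cJ).
have i4 := sections_integrableD i2 i3.
split; last exact: sections_integrableD.
rewrite path_integralD// path_integralD// !path_integralZ//; last 2 first.
- exact: sections_integrable_indic.
- exact: sections_integrable_sqrt.
by rewrite -massE// /loss /sq_dist mulNr addrA.
Qed.

Lemma loss_ge0 J c : is_cube J -> 0 <= loss J c.
Proof.
move=> cJ; rewrite -(lossE c cJ).1; apply: path_integral_ge0 => z.
by rewrite mulr_ge0// sqr_ge0.
Qed.

Lemma loss_partition k J t c : is_cube J -> tree_partition k J t ->
  loss J c = \sum_(K <- t) loss K c.
Proof.
move=> cJ ht; rewrite -(lossE c cJ).1.
have ct K : K \in t -> is_cube K by move=> Kt; have [] := tree_partition_cube d0 cJ ht Kt.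
transitivity (path_integral (fun z => \sum_(K <- t) (Num.sqrt (s z) - c) ^+ 2 * \1_K z)).
  congr path_integral; apply/funext => z.
  by rewrite (indic_tree_partition d0 z cJ ht) mulr_sumr.
rewrite (path_integral_sum _).1; last by move=> K /ct cK; exact: (lossE c cK).2.
by apply: eq_big_seq => K /ct cK; exact: (lossE c cK).1.
Qed.

Lemma Hdist_sqr f g : Hdist mu n x f g ^+ 2 =
  (2 * n%:R)^-1 * path_integral (fun z => (Num.sqrt (f z) - Num.sqrt (g z)) ^+ 2).
Proof.
rewrite /Hdist div1r sqr_sqrtr// mulr_ge0 ?invr_ge0 ?mulr_ge0//.
exact: (path_integral_ge0 (fun z => sqr_ge0 _)).
Qed.

Definition kappa : R := (Num.sqrt 2)^-1.

(** By [Hdist_Tstat_gain], n times the summand of [crit] for two functions equal to a and b on [J].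
    The first coefficient is [alpha] times the 1/2 of H^2. *)
Definition gain J (a b : R) : R :=
  (1 - kappa) / 4 * (Num.sqrt a - Num.sqrt b) ^+ 2 * volume J +
  (kappa / 2 * (Num.sqrt (a + b) * (Num.sqrt b - Num.sqrt a)) * volume J
   + kappa * ((Num.sqrt b - Num.sqrt a) / Num.sqrt (a + b)) * hits n x J
   + (a - b) / 2 * volume J).

Lemma sqrt_indic (c : R) J z : Num.sqrt (c * \1_J z) = Num.sqrt c * \1_J z.
Proof.
by rewrite indicE; case: (_ \in _); rewrite /= ?mulr1 ?mulr0 ?sqrtr0.
Qed.

Lemma indic_sqr J z : \1_J z ^+ 2 = \1_J z :> R.
Proof. by rewrite indicE; case: (_ \in _); rewrite /= ?expr1n ?expr0n. Qed.

Lemma Hdist_Tstat_gain J (a b : R) : (0 < n)%N -> is_cube J ->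
  let f := fun z => a * \1_J z in let g := fun z => b * \1_J z in
  alpha * Hdist mu n x f g ^+ 2 + Tstat mu n x f g = n%:R^-1 * gain J a b.
Proof.
move=> n0 cJ f g.
have n0' : n%:R != 0 :> R by rewrite pnatr_eq0 -lt0n.
have s20 : Num.sqrt 2 != 0 :> R by rewrite gt_eqF// sqrtr_gt0.
have iJ := sections_integrable_indic cJ.
have -> : Hdist mu n x f g ^+ 2 =
    (2 * n%:R)^-1 * ((Num.sqrt a - Num.sqrt b) ^+ 2 * volume J).
  rewrite Hdist_sqr /volume -(path_integralZ _ iJ); congr (_ * path_integral _).
  by apply/funext => z; rewrite /f /g !sqrt_indic -mulrBl exprMn indic_sqr.
have E1 : \sum_(i < n) \int[mu]_y (Num.sqrt (f (x i, y) + g (x i, y)) *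
      (Num.sqrt (g (x i, y)) - Num.sqrt (f (x i, y)))) =
    Num.sqrt (a + b) * (Num.sqrt b - Num.sqrt a) * volume J.
  rewrite /volume -(path_integralZ _ iJ); apply: eq_bigr => i _; apply: eq_Rintegral => y _.
  by rewrite /f /g -mulrDl !sqrt_indic -mulrBl mulrACA -expr2 indic_sqr.
have E2 : \sum_(i < n) (Num.sqrt (g (x i, x i.+1)) - Num.sqrt (f (x i, x i.+1))) /
      Num.sqrt (f (x i, x i.+1) + g (x i, x i.+1)) =
    (Num.sqrt b - Num.sqrt a) / Num.sqrt (a + b) * hits n x J.
  rewrite mulr_sumr; apply: eq_bigr => i _.
  rewrite /f /g -mulrDl !sqrt_indic -mulrBl indicE.
  (* Off [J] the quotient is 0 / 0 = 0. *)
  by case: (_ \in _); rewrite /= ?mulr1// !mulr0 mul0r.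
have E3 : \sum_(i < n) \int[mu]_y (f (x i, y) - g (x i, y)) = (a - b) * volume J.
  rewrite /volume -(path_integralZ _ iJ); apply: eq_bigr => i _; apply: eq_Rintegral => y _.
  by rewrite /f /g mulrBl.
rewrite /Tstat E1 E2 E3 /gain /kappa /alpha !invfM !div1r.
set D := (_ - _) ^+ 2; set E := _ / Num.sqrt (a + b).
by field; rewrite s20.
Qed.

End path_functionals.

Lemma card_set_seq (T : choiceType) (r : seq T) : uniq r -> #|` fset_set [set` r]| = size r.
Proof.
move=> ur; apply/perm_size/uniq_perm; rewrite ?fset_uniq// => y.
by rewrite in_fset_set ?mem_setE//; exact: finite_seq.
Qed.

(** * The oracle inequality on a path *)

Section oracle_inequality.
Context {R : realType} (d : nat).
Hypothesis d0 : (0 < d)%N.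
Local Notation Z := (Rd R d * Rd R d)%type.
Local Notation U := (unit_square R d).
Variables (mu : {measure set (Rd R d) -> \bar R}) (Q : R.-pker (Rd R d) ~> (Rd R d)).
Variable s : Z -> R.
Hypothesis hmu : mu (unit_cube R d) = 1%E.
Hypothesis hs : transition_density mu Q s.
Variables (n : nat) (x : nat -> Rd R d).
Hypothesis n3 : (3 < n)%N.
Implicit Types (J K : set Z) (r t : seq (set Z)).

Let cU : is_cube U := is_cube_unit_square d.

Let n0 : (0 < n)%N. Proof. exact: leq_trans n3. Qed.

Definition coef K : R := hits n x K / volume mu n x K.

Lemma hits_ge0 J : 0 <= hits n x J :> R.
Proof. by apply: sumr_ge0. Qed.

Lemma coef_ge0 K : 0 <= coef K.
Proof. by rewrite divr_ge0 ?hits_ge0 ?volume_ge0. Qed.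

Lemma sum_indic_partition k J r (F : set Z -> R) K z : is_cube J -> tree_partition k J r ->
  K \in r -> K z -> \sum_(K' \in [set` r]) F K' * \1_K' z = F K.
Proof.
move=> cJ hr Kr Kz; rewrite -fsbig_seq; last exact: (tree_partition_uniq d0 cJ hr).
rewrite (bigD1_seq K)//=; last exact: (tree_partition_uniq d0 cJ hr).
rewrite indicE mem_set// mulr1 big1_seq ?addr0// => K' /andP[K'K K'r].
rewrite indicE memNset ?mulr0// => K'z.
case/eqP: K'K; apply: (tree_partition_disjoint d0 cJ hr K'r Kr).
by exists z.
Qed.

Lemma shat_coef k r K z : tree_partition k U r -> K \in r -> K z ->
  shat mu n x [set` r] z = coef K.
Proof. by move=> hr Kr Kz; exact: (sum_indic_partition coef cU hr Kr Kz). Qed.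

Definition overlap K K' : bool := `[< K `&` K' !=set0 >].

Lemma local_gainE k k' r r' K K' : tree_partition k U r -> tree_partition k' U r' ->
  K \in r -> K' \in r' ->
  local_gain mu n x [set` r] [set` r'] K K' =
  if overlap K K' then n%:R^-1 * gain mu n x (K' `&` K) (coef K) (coef K') else 0.
Proof.
move=> hr hr' Kr Kr'; have [cK _] := tree_partition_cube d0 cU hr Kr.
have [cK' _] := tree_partition_cube d0 cU hr' Kr'.
rewrite /local_gain /overlap; case: asboolP => KK'.
  have cJ : is_cube (K' `&` K).
    rewrite setIC; have [h|h] := cube_dichotomy cK cK' KK'.
      by rewrite setIidl.
    by rewrite setIidr.
  rewrite -(Hdist_Tstat_gain hmu x _ _ n0 cJ).
  have e1 : shat mu n x [set` r] \* \1_(K `&` K') = fun z => coef K * \1_(K' `&` K) z.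
    apply/funext => z /=; rewrite setIC indicE; case: (boolP (z \in _)); rewrite ?mulr0// inE.
    by case=> _ Kz; rewrite (shat_coef hr Kr Kz).
  have e2 : shat mu n x [set` r'] \* \1_(K `&` K') = fun z => coef K' * \1_(K' `&` K) z.
    apply/funext => z /=; rewrite setIC indicE; case: (boolP (z \in _)); rewrite ?mulr0// inE.
    by case=> Kz _; rewrite (shat_coef hr' Kr' Kz).
  by rewrite e1 e2.
have -> : K `&` K' = set0 by apply/eqP/negPn/negP => /set0P.
(* Both functions vanish; as multiples of the indicator of [U] they fall under
   [Hdist_Tstat_gain]. *)
have e (f : Z -> R) : f \* \1_set0 = fun z => 0 * \1_U z.
  by apply/funext => z /=; rewrite indic0 mulr0 mul0r.
rewrite !e (Hdist_Tstat_gain hmu x _ _ n0 cU) /gain !(subrr, sqrtr0, addr0, mul0r, mulr0).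
by rewrite expr0n /= !(mulr0, mul0r, addr0).
Qed.

Lemma sum_local_gain k k' r r' K : tree_partition k U r -> tree_partition k' U r' ->
  K \in r ->
  \sum_(K' \in [set` r']) local_gain mu n x [set` r] [set` r'] K K' =
  n%:R^-1 * \sum_(K' <- r' | overlap K K') gain mu n x (K' `&` K) (coef K) (coef K').
Proof.
move=> hr hr' Kr; rewrite -fsbig_seq; last exact: (tree_partition_uniq d0 cU hr').
rewrite mulr_sumr [RHS]big_mkcond /=; apply: eq_big_seq => K' Kr'.
exact: local_gainE hr hr' Kr Kr'.
Qed.

Lemma pen_seq (L : R) r : uniq r -> pen n L [set` r] = n%:R^-1 * (L * (size r)%:R * ln n%:R).
Proof. by move=> ur; rewrite /pen card_set_seq// mulrC. Qed.

Lemma sum_join (F : set Z -> R) r K :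
  \sum_(J <- join_seq r K) F J = \sum_(K' <- r | overlap K K') F (K' `&` K).
Proof. by rewrite big_map big_filter. Qed.

Lemma tree_partition_meet k k' r r' K K' : tree_partition k U r -> tree_partition k' U r' ->
  K \in r -> K' \in r' -> overlap K K' ->
  K' `&` K = K \/ K' `&` K = K' /\ K' `<=` K.
Proof.
move=> hr hr' Kr Kr' /asboolP KK'.
have [cK _] := tree_partition_cube d0 cU hr Kr.
have [cK' _] := tree_partition_cube d0 cU hr' Kr'.
have [h|h] := cube_dichotomy cK cK' KK'; first by left; rewrite setIidr.
by right; rewrite setIidl.
Qed.

Lemma cube_meet k k' r r' K K' : tree_partition k U r -> tree_partition k' U r' ->
  K \in r -> K' \in r' -> overlap K K' -> is_cube (K' `&` K).
Proof.
move=> hr hr' Kr Kr' KK'.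
by have [->|[-> _]] := tree_partition_meet hr hr' Kr Kr' KK';
  [have [] := tree_partition_cube d0 cU hr Kr|have [] := tree_partition_cube d0 cU hr' Kr'].
Qed.

(** Inside [K], a cube of the join is [K] or a cube of [r'] contained in [K], and a cube of [r'] is
    contained in at most one cube of [r]. *)
Lemma sum_size_join k k' r r' : tree_partition k U r -> tree_partition k' U r' ->
  \sum_(K <- r) (size (join_seq r' K))%:R <= (size r)%:R + (size r')%:R :> R.
Proof.
move=> hr hr'.
have ur := tree_partition_uniq d0 cU hr; have ur' := tree_partition_uniq d0 cU hr'.
have h K : K \in r -> (size (join_seq r' K))%:R <=
    1 + \sum_(K' <- r') (`[< K' `<=` K >] && overlap K K')%:R :> R.
  move=> Kr; have [cK KU] := tree_partition_cube d0 cU hr Kr.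
  rewrite -natr_sum -[1]/(1%:R) -natrD ler_nat.
  have sub : {subset join_seq r' K <= K :: [seq K' <- r' | `[< K' `<=` K >] && overlap K K']}.
    move=> J /mapP[K']; rewrite mem_filter => /andP[KK' Kr'] ->.
    have [->|[-> K'K]] := tree_partition_meet hr hr' Kr Kr' KK'; rewrite inE ?eqxx//.
    apply/orP; right; rewrite mem_filter Kr' andbT; apply/andP; split => //.
    exact/asboolP.
  have uj : uniq (join_seq r' K).
    exact: (tree_partition_uniq d0 cK (tree_partition_join d0 cU hr' cK KU)).
  rewrite (leq_trans (uniq_leq_size uj sub))//= size_filter -sum1_count big_mkcond/=.
  by rewrite add1n ltnS; apply: leq_sum => K' _; case: ifP.
rewrite (le_trans (y := \sum_(K <- r) (1 + \sum_(K' <- r') (`[< K' `<=` K >] && overlap K K')%:R)))//.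
  by rewrite !big_seq; apply: ler_sum => K /h.
rewrite big_split/= big_const_seq count_predT iter_addr_0 lerD2l exchange_big/=.
rewrite (le_trans (y := \sum_(K' <- r') 1))//; last first.
  by rewrite big_const_seq count_predT iter_addr_0.
rewrite !big_seq; apply: ler_sum => K' Kr'.
have [[K Kr /andP[/asboolP K'K _]]|no] := pselect (exists2 K, K \in r & `[< K' `<=` K >] && overlap K K').
  rewrite (bigD1_seq K)//= big1_seq ?addr0; first by case: (_ && _).
  move=> K2 /andP[K2K K2r]; case: andP => // -[/asboolP K'K2 _].
  have [cK' _] := tree_partition_cube d0 cU hr' Kr'; have [z K'z] := cube_neq0 cK'.
  case/eqP: K2K; apply: (tree_partition_disjoint d0 cU hr K2r Kr).
  by exists z; split; [exact: K'K2|exact: K'K].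
rewrite big1_seq// => K /andP[_ Kr]; case: (boolP (_ && _)) => // h'.
by exfalso; apply: no; exists K.
Qed.

Definition discrepancy J : R := (Num.sqrt (hits n x J) - Num.sqrt (mass Q n x J)) ^+ 2.

Definition average_tilt J : R :=
  (size (grid (R := R) n))%:R^-1 * \sum_(lam <- grid n) tilt Q n lam x J.

Lemma average_tilt_gt0 J : 0 < average_tilt J.
Proof.
rewrite /average_tilt size_grid mulr_gt0 ?invr_gt0// /grid /= big_cons ltr_pwDl ?expR_gt0//.
by rewrite sumr_ge0// => lam _; exact: expR_ge0.
Qed.

Let n4 : 4 <= n%:R :> R. Proof. by rewrite (ler_nat R 4). Qed.

Lemma expR1_le4 : expR 1 <= 4 :> R.
Proof.
have h : expR 2^-1 <= 2 :> R by have := expR_le_quadratic (lexx (2^-1 : R)); lra.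
rewrite (_ : 1 = 2^-1 + 2^-1 :> R); last by lra.
rewrite expRD (le_trans (ler_pM _ _ h h)) ?expR_ge0//; lra.
Qed.

Lemma ln_n_ge1 : 1 <= ln n%:R :> R.
Proof.
have e4 := expR1_le4; rewrite -[leLHS]expRK ler_ln ?posrE ?expR_gt0 ?ltr0n//.
exact: le_trans e4 n4.
Qed.

(** The average is at least any of its terms divided by 2n + 1. Together ln (2n + 1), ln 8 and 1 are
    at most 5 ln n, since n >= 4. *)
Lemma discrepancy_le J : is_cube J ->
  discrepancy J <= 8 * (ln (average_tilt J) - ln 8) + 40 * ln n%:R.
Proof.
move=> cJ.
have [] := @sqrt_diff_le_grid R n (hits n x J) (mass Q n x J) n0 (hits_ge0 J).
  by rewrite mass_ge0 mass_le.
move=> lam lg /le_trans; apply.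
have nG : 0 < (n.*2.+1)%:R :> R by rewrite ltr0n.
have A0 := average_tilt_gt0 J.
have h : lam * hits n x J - (expR lam - 1) * mass Q n x J <=
    ln (average_tilt J) + ln (n.*2.+1)%:R.
  rewrite -lnM ?posrE// -[leLHS]expRK ler_ln ?posrE ?expR_gt0 ?(mulr_gt0 A0 nG)//.
  rewrite [leRHS]mulrC /average_tilt size_grid mulrA mulfV ?gt_eqF// mul1r.
  rewrite (big_rem lam lg)/= lerDl sumr_ge0// => *; exact: expR_ge0.
have ln_bound : ln (n.*2.+1)%:R + ln 8 + 1 <= 5 * ln n%:R :> R.
  have np : 0 < n%:R :> R by rewrite ltr0n.
  rewrite -[X in _ + X <= _]expRK -!lnM ?posrE ?mulr_gt0 ?expR_gt0//.
  rewrite (_ : 5 * ln n%:R = ln (n%:R ^+ 5)); last by rewrite lnXn// mulr_natl.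
  rewrite ler_ln ?posrE ?mulr_gt0 ?expR_gt0 ?exprn_gt0//.
  have h1 : (n.*2.+1)%:R = 2 * n%:R + 1 :> R by rewrite -natr1 -muln2 natrM mulrC.
  have h2 : (n.*2.+1)%:R * 8 * expR 1 <= (2 * n%:R + 1) * 8 * 4 :> R.
    by rewrite h1 ler_wpM2l ?expR1_le4// mulr_ge0// addr_ge0.
  have h3 : 256 * n%:R <= n%:R ^+ 5 :> R.
    rewrite exprSr ler_wpM2r ?ler0n// (le_trans _ (lerXn2r 4 _ _ n4)) ?nnegrE//.
    by rewrite -natrX.
  move: h2 h3 n4; lra.
by move: h ln_bound; lra.
Qed.

(** As [b] does not depend on [t], the partition may be chosen separately inside each [K], which the
    suprema in [crit] require. *)
Lemma sum_discrepancy (B : R) k r : (forall i, tree_weight average_tilt i U <= B) ->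
  tree_partition k U r ->
  exists b : set Z -> R,
    (forall K i t, K \in r -> tree_partition i K t ->
       \sum_(J <- t) discrepancy J <= 8 * b K + 40 * ln n%:R * (size t)%:R) /\
    \sum_(K <- r) 8 * b K <= 8 * ln B + 8 * ln n%:R * (size r)%:R.
Proof.
move=> hB hr.
have [b [hb sb]] := tree_weight_ln_bound d0 average_tilt_gt0 cU hB hr.
exists b; split.
  move=> K i t Kr ht; have [cK _] := tree_partition_cube d0 cU hr Kr.
  apply: (@le_trans _ _ (\sum_(J <- t) (8 * (ln (average_tilt J) - ln 8) + 40 * ln n%:R))).
    rewrite !big_seq; apply: ler_sum => J Jt; apply: discrepancy_le.
    by have [] := tree_partition_cube d0 cK ht Jt.
  rewrite big_split/= big_const_seq count_predT iter_addr_0 -[X in _ + X]mulr_natr.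
  by rewrite lerD2r -mulr_sumr ler_pM2l//; exact: (hb _ _ _ Kr ht).
have ln4 : ln 4 <= ln n%:R :> R by rewrite ler_ln ?posrE ?ltr0n.
have := ler_wpM2l (ler0n R (size r)) ln4.
by rewrite -mulr_sumr; lra.
Qed.

End oracle_inequality.

(** * Comparison of the criterion at two partitions *)

Section pathwise_oracle.
Context {R : realType} (d : nat).
Hypothesis d0 : (0 < d)%N.
Local Notation Z := (Rd R d * Rd R d)%type.
Local Notation U := (unit_square R d).
Variables (mu : {measure set (Rd R d) -> \bar R}) (Q : R.-pker (Rd R d) ~> (Rd R d)).
Variable s : Z -> R.
Hypothesis hmu : mu (unit_cube R d) = 1%E.
Hypothesis hs : transition_density mu Q s.
Variables (n : nat) (x : nat -> Rd R d).
Hypothesis n3 : (3 < n)%N.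
Implicit Types (J K : set Z) (r t : seq (set Z)) (L : R).

Let cU : is_cube U := is_cube_unit_square d.
Let n0 : (0 < n)%N. Proof. exact: leq_trans n3. Qed.
Let np : 0 < n%:R :> R. Proof. by rewrite ltr0n. Qed.

Local Notation loss := (loss mu Q s n x).
Local Notation disc := (discrepancy Q n x).
Local Notation coef := (coef mu n x).
Local Notation gain := (gain mu n x).

Lemma kappa_gt0 : 0 < kappa :> R.
Proof. by rewrite /kappa invr_gt0 sqrtr_gt0. Qed.

Lemma kappa_sqr : kappa ^+ 2 = 2^-1 :> R.
Proof. by rewrite /kappa exprVn sqr_sqrtr. Qed.

Lemma gain_upper J a b : is_cube J -> 0 <= a -> 0 <= b ->
  gain J a b <= 2 * loss J (Num.sqrt a) + 65 * disc J.
Proof.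
move=> cJ a0 b0; have ab0 : 0 <= a + b by rewrite addr_ge0.
have rho2 : Num.sqrt (a + b) ^+ 2 = Num.sqrt a ^+ 2 + Num.sqrt b ^+ 2.
  by rewrite !sqr_sqrtr.
rewrite /gain (_ : a - b = Num.sqrt a ^+ 2 - Num.sqrt b ^+ 2); last by rewrite !sqr_sqrtr.
apply: (gain_le (v := Num.sqrt (hits n x J)) (w := Num.sqrt (mass Q n x J)) (S := mass Q n x J)
  (C := sqrt_mass mu s n x J)) => //.
- by rewrite sqr_sqrtr// hits_ge0.
- by rewrite sqr_sqrtr// mass_ge0.
- exact: sqrt_mass_ge0.
- exact: volume_ge0.
- by move=> c; exact: (loss_ge0 hmu hs n x c cJ).
- exact/ltW/kappa_gt0.
- exact: kappa_sqr.
(* If a = b = 0, the quotient playing the role of psi is 0 / 0 = 0 and the relation still holds. *)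
- have [e|e] := eqVneq (Num.sqrt (a + b)) 0; last by rewrite divfK.
  have := rho2; rewrite e expr0n /= => /esym/eqP.
  by rewrite paddr_eq0 ?sqr_ge0// !sqrf_eq0 => /andP[/eqP -> /eqP ->]; rewrite subrr !mul0r.
- have [e|e] := eqVneq (Num.sqrt (a + b)) 0; first by rewrite e invr0 mulr0 expr0n.
  rewrite expr_div_n rho2 ler_pdivrMr; last first.
    by rewrite -rho2 exprn_gt0// lt_neqAle eq_sym e sqrtr_ge0.
  by rewrite mul1r; have := mulr_ge0 (sqrtr_ge0 a) (sqrtr_ge0 b); lra.
Qed.

(** Exchanging a and b reverses the sign of the test and keeps the distance, so the two gains add up
    to a multiple of the squared difference. [gain_upper] bounds the exchanged one, and (1 -
    kappa)/2 >= 1/8. *)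
Lemma gain_lower J a b : is_cube J -> 0 <= a -> 0 <= b ->
  8^-1 * ((Num.sqrt a - Num.sqrt b) ^+ 2 * volume mu n x J)
    - 2 * loss J (Num.sqrt b) - 65 * disc J <= gain J a b.
Proof.
move=> cJ a0 b0; have := gain_upper cJ b0 a0.
have -> : gain J b a = (1 - kappa) / 2 * ((Num.sqrt a - Num.sqrt b) ^+ 2 * volume mu n x J)
    - gain J a b.
  by rewrite /gain [b + a]addrC; set q := _ / Num.sqrt (a + b); set q' := _ / Num.sqrt (a + b);
     have -> : q = - q'; [rewrite /q /q' -mulNr opprB|field].
have k34 : kappa <= 3 / 4 :> R.
  have k34' : 0 <= 3 / 4 :> R by lra.
  by rewrite -ler_sqr ?nnegrE ?(ltW kappa_gt0)// kappa_sqr; lra.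
have k1 : 0 <= (3 / 4 - kappa) / 2 :> R by lra.
have := mulr_ge0 k1 (mulr_ge0 (sqr_ge0 (Num.sqrt a - Num.sqrt b)) (volume_ge0 mu n x J)).
lra.
Qed.

Lemma Hdist_step k r (a : set Z -> R) : tree_partition k U r ->
  Hdist mu n x (s \* \1_U) (fun z => \sum_(K \in [set` r]) a K * \1_K z) ^+ 2 =
  (2 * n%:R)^-1 * \sum_(K <- r) loss K (Num.sqrt (a K)).
Proof.
move=> hr; rewrite Hdist_sqr; congr (_ * _).
have cr K : K \in r -> is_cube K by move=> Kr; have [] := tree_partition_cube d0 cU hr Kr.
have ur := tree_partition_uniq d0 cU hr.
transitivity (path_integral mu n x
    (fun z => \sum_(K <- r) (Num.sqrt (s z) - Num.sqrt (a K)) ^+ 2 * \1_K z)).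
  congr path_integral; apply/funext => z /=.
  have [Uz|Uz] := pselect (U z).
    have [K Kr Kz] := tree_partition_cover d0 cU hr Uz.
    rewrite (sum_indic_partition d0 a cU hr Kr Kz) indicE mem_set// mulr1.
    rewrite [RHS](fsbig_seq _ _ ur).
    by rewrite (sum_indic_partition d0 (fun K => (Num.sqrt (s z) - Num.sqrt (a K)) ^+ 2) cU hr Kr Kz).
  have nz K : K \in r -> \1_K z = 0 :> R.
    move=> Kr; rewrite indicE memNset// => Kz; apply: Uz.
    by apply: (tree_partition_cube d0 cU hr Kr).2.
  rewrite indicE memNset// mulr0 sqrtr0 -fsbig_seq// big1_seq; last first.
    by move=> K /andP[_ Kr]; rewrite nz// mulr0.
  rewrite sqrtr0 subrr expr0n /= big1_seq// => K /andP[_ Kr].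
  by rewrite nz// mulr0.
rewrite (path_integral_sum _ _ _).1; last by move=> K /cr cK; exact: (lossE hmu hs n x _ cK).2.
by apply: eq_big_seq => K /cr cK; exact: (lossE hmu hs n x _ cK).1.
Qed.

Lemma loss_join k k' r r' K c : tree_partition k U r -> tree_partition k' U r' -> K \in r ->
  \sum_(K' <- r' | overlap K K') loss (K' `&` K) c = loss K c.
Proof.
move=> hr hr' Kr; have [cK KU] := tree_partition_cube d0 cU hr Kr.
rewrite (loss_partition d0 hmu hs n x c cK (tree_partition_join d0 cU hr' cK KU)).
by rewrite sum_join.
Qed.

Lemma overlapC K K' : overlap K K' = overlap K' K.
Proof. by rewrite /overlap setIC. Qed.

Lemma sum_loss_exchange k k' r r' (c : set Z -> R) :
  tree_partition k U r -> tree_partition k' U r' ->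
  \sum_(K <- r) \sum_(K' <- r' | overlap K K') loss (K' `&` K) (c K') =
  \sum_(K' <- r') loss K' (c K').
Proof.
move=> hr hr'; under eq_bigr do rewrite big_mkcond.
rewrite exchange_big /=; apply: eq_big_seq => K' Kr'.
rewrite -big_mkcond -(loss_join (c K') hr' hr Kr') /=.
by apply: eq_big => K; [exact: overlapC|rewrite setIC].
Qed.

(** The penalty of the join absorbs 65 times 40 ln n per cube, which leaves a bound independent of
    [m']. *)
Lemma sup_gain_upper L l k r (b : set Z -> R) K : 48 * 65 <= L -> tree_partition k U r ->
  (forall K i t, K \in r -> tree_partition i K t ->
       \sum_(J <- t) disc J <= 8 * b K + 40 * ln n%:R * (size t)%:R) ->
  K \in r ->
  (ereal_sup [set (\sum_(K' \in m') local_gain mu n x [set` r] m' K K'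
       - pen n L (join_cube m' K))%:E | m' in partitions l] <=
   (n%:R^-1 * (2 * loss K (Num.sqrt (coef K)) + 65 * (8 * b K)))%:E)%E.
Proof.
move=> L0; have aux (G D l' b' sz v : R) : 0 <= sz -> 1 <= v -> G <= 2 * l' + 65 * D ->
    D <= 8 * b' + 40 * v * sz -> G - L * sz * v <= 2 * l' + 65 * (8 * b').
  move=> sz0 v1 h1 h2; have h3 : 0 <= (L - 40 * 65) * (v * sz).
    by rewrite mulr_ge0 ?mulr_ge0//; lra.
  by move: h1 h2 h3; lra.
move=> hr hb Kr; apply: ge_ereal_sup => _ [m' pm' <-].
have [k' [r' [hr' ->]]] := tree_partitionP d0 pm'.
have [cK KU] := tree_partition_cube d0 cU hr Kr.
have hj := tree_partition_join d0 cU hr' cK KU.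
rewrite (sum_local_gain d0 hmu x n3 hr hr' Kr) join_cubeE pen_seq; last first.
  exact: (tree_partition_uniq d0 cK hj).
rewrite lee_fin -mulrBr ler_pM2l ?invr_gt0//.
have h1 : \sum_(K' <- r' | overlap K K') gain (K' `&` K) (coef K) (coef K') <=
    2 * (\sum_(K' <- r' | overlap K K') loss (K' `&` K) (Num.sqrt (coef K))) +
    65 * \sum_(K' <- r' | overlap K K') disc (K' `&` K).
  rewrite !mulr_sumr -big_split/= big_seq_cond [leRHS]big_seq_cond.
  apply: ler_sum => K' /andP[Kr' KK'].
  by apply: gain_upper; rewrite ?coef_ge0//; exact: (cube_meet d0 hr hr').
rewrite (loss_join _ hr hr' Kr) in h1.
have h2 := hb _ _ _ Kr hj; rewrite sum_join in h2.
by apply: aux h1 h2 => //; exact: ln_n_ge1.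
Qed.

Lemma crit_upper L l k r (b : set Z -> R) : 48 * 65 <= L -> tree_partition k U r ->
  (forall K i t, K \in r -> tree_partition i K t ->
       \sum_(J <- t) disc J <= 8 * b K + 40 * ln n%:R * (size t)%:R) ->
  (crit mu n x L l [set` r] <= (n%:R^-1 *
     (2 * (\sum_(K <- r) loss K (Num.sqrt (coef K))) + 65 * \sum_(K <- r) 8 * b K
      + 2 * (L * (size r)%:R * ln n%:R)))%:E)%E.
Proof.
move=> L0 hr hb; have ur := tree_partition_uniq d0 cU hr.
rewrite /crit -fsbig_seq// pen_seq//.
rewrite mulrDr EFinD [2 * (n%:R^-1 * _)]mulrCA; apply: leeD => //.
rewrite !mulr_sumr -big_split/= mulr_sumr -sumEFin !big_seq; apply: lee_sum => K Kr.
exact: (sup_gain_upper _ L0 hr hb Kr).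
Qed.

(** Takes the same [r'] in the suprema of all the cubes. *)
Lemma crit_lower L l k k' r r' : tree_partition k U r -> tree_partition k' U r' ->
  partitions l [set` r'] ->
  ((n%:R^-1 * (\sum_(K <- r) (\sum_(K' <- r' | overlap K K')
        gain (K' `&` K) (coef K) (coef K') - L * (size (join_seq r' K))%:R * ln n%:R)
      + 2 * (L * (size r)%:R * ln n%:R)))%:E <= crit mu n x L l [set` r])%E.
Proof.
move=> hr hr' pr'; have ur := tree_partition_uniq d0 cU hr.
rewrite /crit -fsbig_seq// pen_seq//.
rewrite mulrDr EFinD [2 * (n%:R^-1 * _)]mulrCA; apply: leeD => //.
rewrite mulr_sumr -sumEFin !big_seq; apply: lee_sum => K Kr.
have [cK KU] := tree_partition_cube d0 cU hr Kr.
apply: ereal_sup_ubound; exists [set` r'] => //.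
rewrite (sum_local_gain d0 hmu x n3 hr hr' Kr) join_cubeE pen_seq ?mulrBr//.
exact: (tree_partition_uniq d0 cK (tree_partition_join d0 cU hr' cK KU)).
Qed.

(** Here v is ln n, nr and nrh are the sizes of m and of the selected partition, SJ counts the cubes
    of their joins, hr and hrh are the losses of their histograms, H that of the step function, and
    SV compares the histograms. As SJ <= nrh + nr, twice the penalty leaves L nrh v, which absorbs
    65 (40 + 8) v nrh: hence 48 times 65. *)
Lemma oracle_arith L v nr nrh SJ G Dh D SV SB SBh hr hrh H lB :
  48 * 65 <= L -> 1 <= v -> 1 <= nr -> 0 <= nrh -> SJ <= nrh + nr ->
  G - L * SJ * v + 2 * (L * nrh * v) <= 2 * hr + 65 * SB + 2 * (L * nr * v) + 1 ->
  8^-1 * SV - 2 * hr - 65 * Dh <= G -> Dh <= SBh + 40 * v * SJ -> D <= SB + 40 * v * nr ->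
  SB <= 8 * lB + 8 * v * nr -> SBh <= 8 * lB + 8 * v * nrh ->
  hrh <= 2 * hr + 2 * SV -> hr <= 4 * H + 2 * D ->
  hrh <= 264 * H + 32 * 553 * lB + 84 * (L * nr * v).
Proof.
move=> L0 v1 nr1 nrh0 SJ_le e1 e2 e3 e4 e5 e6 e7 e8.
have L00 : 0 <= L by apply: le_trans L0; lra.
have L1 : 0 <= L - 48 * 65 by lra.
have v0 : 0 <= v by lra.
have f1 : 0 <= v * (nrh + nr - SJ) by rewrite mulr_ge0//; lra.
have f2 : 0 <= L * (v * (nrh + nr - SJ)) by rewrite mulr_ge0.
have q0 : 1 <= v * nr.
  have : 0 <= (v - 1) * (nr - 1) by rewrite mulr_ge0//; lra.
  by lra.
have f3 : 0 <= (L - 48 * 65) * (v * nr) by rewrite mulr_ge0//; lra.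
have f4 : 0 <= (L - 48 * 65) * (v * nrh) by rewrite mulr_ge0// mulr_ge0.
clear L0 L1 v1 nr1 SJ_le L00.
(* Then hrh <= 66 hr + ..., so that 264 = 66 * 4 and 32 * 553 = 16 * 16 * 65 + 132 * 8. *)
have SV_le : SV <= 32 * hr + 8 * 16 * 65 * lB + 40 * (L * nr * v) by lra.
lra.
Qed.

(** Near minimality joins the upper bound at [m] to the lower bound at [mhat] tested against [m].
    This controls the distance between the two histograms; [sq_dist_triangle] and
    [sq_dist_histogram] lead from there to [g]. *)
Lemma oracle_path L l mhat m (g : Z -> R) (B : R) : 48 * 65 <= L ->
  selected mu n x L l mhat -> partitions l m -> stepfuns m g ->
  (forall i, tree_weight (average_tilt Q n x) i U <= B) ->
  Hdist mu n x (s \* \1_U) (shat mu n x mhat) ^+ 2 <=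
    264 * Hdist mu n x (s \* \1_U) g ^+ 2 + 16 * 553 * ln B / n%:R + 42 * pen n L m.
Proof.
move=> L0 [pmhat selm] pm [c c0 ->] hB.
have [k [r [hr em]]] := tree_partitionP d0 pm.
have [kh [rh [hrh emh]]] := tree_partitionP d0 pmhat.
have ur := tree_partition_uniq d0 cU hr; have urh := tree_partition_uniq d0 cU hrh.
have cr K : K \in r -> is_cube K by move=> Kr; have [] := tree_partition_cube d0 cU hr Kr.
have crh K : K \in rh -> is_cube K by move=> Kr; have [] := tree_partition_cube d0 cU hrh Kr.
have [b [hb sb]] := sum_discrepancy d0 n3 hB hr.
have [bh [hbh sbh]] := sum_discrepancy d0 n3 hB hrh.
have hcu := crit_upper l L0 hr hb.
have hcl := @crit_lower L l _ _ _ _ hrh hr; rewrite -em in hcl; have {}hcl := hcl pm.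
have : (crit mu n x L l [set` rh] <= crit mu n x L l [set` r] + (n%:R^-1)%:E)%E.
  rewrite -emh -em -(div1r n%:R) (le_trans selm)//; apply: leeD => //.
  by apply: ereal_inf_lbound; exists m.
move=> /(le_trans hcl)/le_trans/(_ (leeD hcu (lexx _))).
rewrite -EFinD lee_fin -[X in _ <= _ + X]mulr1 -mulrDr ler_pM2l ?invr_gt0// => {}hcl.
rewrite em emh (Hdist_step coef hrh) (Hdist_step c hr) pen_seq//.
have nr1 : 1 <= (size r)%:R :> R by rewrite ler1n; exact: (tree_partition_neq0 d0 cU hr).
(* The factor 1/(2n) of H^2 halves 32 * 553 and 84. *)
suff : \sum_(K <- rh) loss K (Num.sqrt (coef K)) <=
    264 * (\sum_(K <- r) loss K (Num.sqrt (c K))) + 32 * 553 * ln B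
    + 84 * (L * (size r)%:R * ln n%:R).
  have n2 : 0 <= (2 * n%:R)^-1 :> R by rewrite invr_ge0 mulr_ge0.
  move=> /(ler_wpM2l n2)/le_trans; apply.
  rewrite le_eqVlt; apply/orP; left; apply/eqP.
  by field; rewrite gt_eqF.
rewrite sumrB in hcl.
rewrite -[X in _ - X + _ <= _]mulr_suml -mulr_sumr in hcl.
pose Dh := \sum_(K <- rh) \sum_(K' <- r | overlap K K') disc (K' `&` K).
pose SV := \sum_(K <- rh) \sum_(K' <- r | overlap K K')
  (Num.sqrt (coef K) - Num.sqrt (coef K')) ^+ 2 * volume mu n x (K' `&` K).
apply: (oracle_arith (Dh := Dh) (D := \sum_(K <- r) disc K) (SV := SV)
  L0 _ nr1 _ _ hcl _ _ _ sb sbh).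
- exact: ln_n_ge1.
- by [].
- exact: (sum_size_join d0 hrh hr).
- rewrite -(sum_loss_exchange (fun K => Num.sqrt (coef K)) hrh hr) /Dh /SV.
  rewrite !mulr_sumr -!sumrB big_seq [leRHS]big_seq; apply: ler_sum => K Kr.
  rewrite !mulr_sumr -!sumrB big_seq_cond [leRHS]big_seq_cond; apply: ler_sum => K' /andP[Kr' KK'].
  by apply: gain_lower; rewrite ?coef_ge0//; exact: (cube_meet d0 hrh hr).
- rewrite /Dh mulr_sumr -big_split big_seq [leRHS]big_seq; apply: ler_sum => K Kr /=.
  have [cK KU] := tree_partition_cube d0 cU hrh Kr.
  by rewrite -sum_join; apply: (hbh _ _ _ Kr (tree_partition_join d0 cU hr cK KU)).
- rewrite -sum1_size natr_sum mulr_sumr -big_split big_seq [leRHS]big_seq.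
  apply: ler_sum => K Kr /=.
  by have := hb _ _ _ Kr (tree_partition1 0 K); rewrite big_seq1.
- rewrite -(sum_loss_exchange (fun K => Num.sqrt (coef K)) hrh hr) /SV.
  rewrite !mulr_sumr -!big_split big_seq [leRHS]big_seq; apply: ler_sum => K Kr.
  rewrite -(loss_join _ hrh hr Kr) !mulr_sumr -!big_split.
  rewrite big_seq_cond [leRHS]big_seq_cond; apply: ler_sum => K' /andP[Kr' KK'] /=.
  apply: sq_dist_triangle => e; apply: (loss_ge0 hmu hs n x e).
  exact: (cube_meet d0 hrh hr).
- rewrite !mulr_sumr -!big_split big_seq [leRHS]big_seq; apply: ler_sum => K Kr /=.
  apply: sq_dist_histogram; rewrite ?hits_ge0 ?mass_ge0 ?sqrt_mass_ge0 ?volume_ge0//.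
  by move=> e; apply: (loss_ge0 hmu hs n x e); exact: cr.
Qed.

End pathwise_oracle.

(** * Expectations of possibly non-measurable functions *)

Section lower_integral.
Local Open Scope ereal_scope.
Import HBNNSimple.
Context {dT} {T : measurableType dT} {R : realType} (mu : {measure set T -> \bar R}).
Implicit Types f g h : T -> \bar R.

(* The integral of a non-negative function is a supremum over the simple functions below
   it, whether or not the function is measurable. *)
Lemma le_lower_integral f g : (forall w, 0 <= f w) -> (forall w, f w <= g w) ->
  \int[mu]_w f w <= \int[mu]_w g w.
Proof.
move=> f0 fg; have g0 w : 0 <= g w by rewrite (le_trans (f0 w)).
rewrite !ge0_integralTE//; apply: ereal_sup_le => _ [phi hphi <-].
by exists phi => // w; rewrite (le_trans (hphi w)).
Qed.

(** For a simple phi below [f], the function max (phi - h, 0) / c is measurable and below [g], so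
    its integral is at most that of [g]. In the application [f] comes from an arbitrary selection
    and [g] from an infimum. *)
Lemma lower_integral_le_add (c : R) f g h : (0 < c)%R ->
  (forall w, 0 <= f w) -> (forall w, 0 <= g w) -> (forall w, 0 <= h w) ->
  measurable_fun setT h -> (forall w, f w <= c%:E * g w + h w) ->
  \int[mu]_w f w <= c%:E * \int[mu]_w g w + \int[mu]_w h w.
Proof.
move=> c0 f0 g0 h0 mh fgh.
rewrite [leLHS]ge0_integralTE//; apply: ge_ereal_sup => _ [phi hphi <-].
pose psi w := c^-1%:E * maxe ((phi w)%:E - h w) 0.
have psi0 w : 0 <= psi w by rewrite mule_ge0 ?lee_fin ?invr_ge0 ?(ltW c0)// le_max lexx orbT.
have mphi : measurable_fun setT (fun w => (phi w)%:E) by exact/measurable_EFinP.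
have mpsi : measurable_fun setT psi.
  by apply: measurable_funeM; apply: measurable_maxe => //; exact: emeasurable_funB.
have psi_le w : psi w <= g w.
  rewrite lee_pdivrMl// ge_max mule_ge0 ?lee_fin ?(ltW c0)// andbT.
  have := le_trans (hphi w) (fgh w); have := h0 w.
  (* Where [h w] is infinite, the difference is -oo. *)
  case: (h w) => [b _|_ _|]; last by rewrite leeNy_eq.
    by rewrite -leeBlDr.
  by rewrite addeNy leNye.
have -> : sintegral mu phi = \int[mu]_w (phi w)%:E.
  by rewrite integral_nnsfun// patch_setT.
apply: (@le_trans _ _ (\int[mu]_w (c%:E * psi w + h w))).
  apply: ge0_le_integral => //.
  - by move=> w _; rewrite lee_fin.
  - by apply: emeasurable_funD => //; exact: measurable_funeM.
  - move=> w _; rewrite /psi muleA -EFinM mulfV ?gt_eqF// mul1e.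
    have := h0 w; case: (h w) => [b b0|_|//]; last first.
      by rewrite addey ?leey// gt_eqF// lt_max ltNy0 orbT.
    by rewrite -leeBlDr// le_max lexx.
rewrite ge0_integralD//; last 2 first.
- by move=> w _; rewrite mule_ge0// lee_fin ltW.
- exact: measurable_funeM.
rewrite ge0_integralZl//; last by rewrite lee_fin ltW.
rewrite leeD2r// lee_wpmul2l ?lee_fin ?(ltW c0)//.
exact: le_lower_integral.
Qed.

End lower_integral.

(** * Integration over the paths *)

Theorem theorem2 (R : realType) :
  exists L0 C : R, [/\ 0 < L0, 0 < C &
  forall (d n : nat) (hd : (1 <= d)%N) (hn : (3 < n)%N)
    (mu : {measure set (Rd R d) -> \bar R}) (hmu : mu (unit_cube R d) = 1%E)
    (dO : measure_display) (Omega : measurableType dO)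
    (P : probability Omega R) (X : nat -> {RV P >-> Rd R d})
    (Q : R.-pker (Rd R d) ~> (Rd R d)) (s : Rd R d * Rd R d -> R)
    (hX : homogeneous_markov_chain X Q) (hs : transition_density mu Q s)
    (L : R) (hL : L0 <= L)
    (l : option nat) (hl : forall k, l = Some k -> (1 <= k)%N)
    (mhat : Omega -> set (set (Rd R d * Rd R d)))
    (hmhat : forall w, selected mu n (fun i => X i w) L l (mhat w)),
    let sA := s \* \1_(unit_square R d) in
    (C%:E * 'E_P[fun w => (Hdist mu n (fun i => X i w) sA
                             (shat mu n (fun i => X i w) (mhat w)) ^+ 2)%R]
     <= ereal_inf
          [set 'E_P[fun w => (Hdist_set mu n (fun i => X i w) sA
                                (stepfuns m) ^+ 2)%R]
               + (pen n L m)%:E | m in partitions l])%E].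
Proof.
(* The constants of [oracle_path], kept opaque until the last computation. *)
have [c1 c1_gt0 c1E] : exists2 c1 : R, 0 < c1 & c1 = 16 * 553.
  by exists (16 * 553); [rewrite mulr_gt0 ?ltr0n|].
have [c2 c2_gt0 c2E] : exists2 c2 : R, 0 < c2 & c2 = 264.
  by exists 264; [rewrite ltr0n|].
exists (48 * 65), c2^-1; split; [by rewrite mulr_gt0|by rewrite invr_gt0|].
move=> d n hd hn mu hmu dO Omega P X Q s hX hs L hL l hl mhat hmhat /=; set sA := s \* _.
have n0 : (0 < n)%N by exact: leq_trans hn.
have np : 0 < n%:R :> R by rewrite ltr0n.
pose G := grid (R := R) n.
have G0 : (0 < size G)%N by rewrite size_grid.
pose U := unit_square R d.
have cU : is_cube U := is_cube_unit_square d.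
pose W k (w : Omega) := tree_weight (average_tilt Q n (fun i => X i w)) k U.
have mixW k := mixture_tree_weight hd Q n k G0 cU.
(* One random bound for every depth, hence valid for [m] and for each [mhat w] at once. *)
have [B [mB B0 WB intB]] : exists B : Omega -> \bar R, [/\ measurable_fun setT B,
    forall w, (0 <= B w)%E, forall k w, ((W k w)%:E <= B w)%E
    & (\int[P]_w B w <= 1)%E].
  apply: monotone_bound => k.
  - by move=> w; apply/ltW/tree_weight_gt0 => K; exact: average_tilt_gt0.
  - exact: (measurable_mixture X (mixW k)).
  - by move=> w; apply: tree_weightS => K; exact: average_tilt_gt0.
  - exact: (expectation_mixture_le1 hX (mixW k)).
apply: le_ereal_inf_tmp => _ [m pm <-].
have [km [r [hr em]]] := tree_partitionP hd pm.
(* Since |m| >= 1 and ln n >= 1, the penalty can absorb a remainder of order 1/n. *)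
have pen_ge : 48 * 65 / n%:R <= pen n L m.
  rewrite em pen_seq; last exact: (tree_partition_uniq hd cU hr).
  rewrite mulrC ler_wpM2l ?invr_ge0//.
  rewrite -[leLHS]mulr1 -[X in X * 1 <= _]mulr1 ler_pM//.
  - by rewrite ler_pM// ler1n; exact: (tree_partition_neq0 hd cU hr).
  - exact: ln_n_ge1.
have pen0 : 0 <= pen n L m by apply: le_trans pen_ge; rewrite divr_ge0.
set f := fun w => _ ^+ 2; set g := fun w => Hdist_set _ _ _ _ _ ^+ 2.
pose h w := ((c1 / n%:R)%:E * B w + (42 * pen n L m)%:E)%E.
have c1n_gt0 : 0 < c1 / n%:R by rewrite divr_gt0.
have c1n := ltW c1n_gt0.
have h_ge0 w : (0 <= h w)%E.
  by apply: adde_ge0; [exact: mule_ge0|rewrite lee_fin mulr_ge0].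
have mh : measurable_fun setT h.
  rewrite /h; apply: emeasurable_funD; last exact: measurable_cst.
  exact: measurable_funeM.
have fgh w : ((f w)%:E <= c2%:E * (g w)%:E + h w)%E.
  (* Where [B w] is infinite the bound is trivial. *)
  have := WB ^~ w; have := B0 w; rewrite /h; case: (B w) => [b b0 Wb|_ _|//]; last first.
    by rewrite gt0_muley ?lte_fin// addye// addey ?leey// -EFinM.
  rewrite -!EFinM -!EFinD lee_fin.
  have Wb' k : W k w <= b by rewrite -lee_fin Wb.
  have bp : 0 < b.
    by rewrite (lt_le_trans _ (Wb' 0%N))// tree_weight_gt0// => K; exact: average_tilt_gt0.
  have step gg := oracle_path hd hmu hs hn hL (hmhat w) pm (g := gg) ^~ Wb'.
  rewrite -c1E -c2E in step.
  (* ln b <= b trades the logarithm for [B] itself, whose expectation is at most 1. *)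
  have lnb : c1 * ln b / n%:R <= c1 / n%:R * b.
    rewrite mulrAC ler_wpM2l//.
    exact/ltW/ln_sublinear.
  set V := [set Hdist mu n (fun i => X i w) sA gg | gg in stepfuns m].
  have V0 : V !=set0.
    pose gg : Rd R d * Rd R d -> R := fun z => \sum_(K \in m) (0 : R) * \1_K z.
    by exists (Hdist mu n (fun i => X i w) sA gg), gg => //; exists (fun=> 0).
  pose c := c1 * ln b / n%:R + 42 * pen n L m.
  (* Passage to the infimum over the step functions: when f w > c, the root of (f w - c) / c2 is a
     lower bound of all the distances. *)
  have key : f w - c <= c2 * g w.
    have [fc|fc] := leP (f w) c.
      by rewrite (@le_trans _ _ 0)// ?subr_le0// mulr_ge0 ?(ltW c2_gt0)// /g sqr_ge0.
    have q0 : 0 <= (f w - c) / c2 by rewrite divr_ge0 ?subr_ge0 ?(ltW fc) ?(ltW c2_gt0).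
    rewrite -ler_pdivrMl// mulrC -(sqr_sqrtr q0) /g ler_sqr ?nnegrE//; last first.
      by rewrite /Hdist_set; apply: lb_le_inf => // _ [gg _ <-]; exact: sqrtr_ge0.
    apply: lb_le_inf => // _ [gg hgg <-].
    rewrite -ler_sqr ?nnegrE ?sqrtr_ge0 ?(sqr_sqrtr q0) ?(ler_pdivrMr _ _ c2_gt0); [|by []..].
    by rewrite mulrC lerBlDr addrA; exact: step.
  by move: key lnb; rewrite /c; clear; lra.
have intfg : (\int[P]_w (f w)%:E <= c2%:E * \int[P]_w (g w)%:E + \int[P]_w h w)%E.
  apply: lower_integral_le_add => //.
  - by move=> w; rewrite lee_fin sqr_ge0.
  - by move=> w; rewrite lee_fin sqr_ge0.
have inth : (\int[P]_w h w <= (c2 * pen n L m)%:E)%E.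
  rewrite ge0_integralD//; last 3 first.
  - by move=> w _; exact: mule_ge0.
  - exact: measurable_funeM.
  - by move=> w _; rewrite lee_fin mulr_ge0.
  rewrite ge0_integralZl// integral_cst// [X in (_ + _ * X)%E](probability_setT P) mule1.
  apply: (@le_trans _ _ ((c1 / n%:R)%:E * 1 + (42 * pen n L m)%:E)%E).
    by rewrite leeD2r// lee_wpmul2l.
  rewrite mule1 -EFinD lee_fin.
  have n10 : 0 < n%:R^-1 :> R by rewrite invr_gt0.
  (* By [pen_ge], 16 * 553 / n is at most (264 - 42) times the penalty. *)
  rewrite c1E c2E; clear -pen_ge n10; lra.
rewrite !unlock lee_pdivrMl// (le_trans intfg)//.
have g0 : (0 <= \int[P]_w (g w)%:E)%E.
  by apply: integral_ge0 => w _; rewrite lee_fin sqr_ge0.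
rewrite (ge0_muleDr _ g0 (_ : (0 <= (pen n L m)%:E)%E)) ?lee_fin//.
exact: leeD (lexx _) inth.
Qed.
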